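(* Let $F$ be a global field. The category $\mathrm{SMod}_F$ is quasi-abelian. That is to say, given a short exact sequence $E=[0\to M_1\xrightarrow{\iota}M\xrightarrow{\pi}M_2\to0]$ in $\mathrm{SMod}_F$, the pullback of $E$ along any morphism $N_2\to M_2$ in $\mathrm{SMod}_F$ is a short exact sequence in $\mathrm{SMod}_F$; and dually, the pushout of $E$ along any morphism $M_1\to N_1$ in $\mathrm{SMod}_F$ is a short exact sequence in $\mathrm{SMod}_F$.
   Context: $G_F=\mathrm{Gal}(F^s/F)$; for each place $v$, $G_v\subseteq G_F$ is the absolute Galois group of $F_v$, $I_v$ its inertia subgroup ($=G_v$ if $v$ is archimedean), $H^1_{\mathrm{ur}}(G_v,M)=\ker(H^1(G_v,M)\to H^1(I_v,M))$. $\mathrm{SMod}_F$: objects are pairs $(M,\mathscr{W})$ (often written $M$), $M$ a finite discrete $G_F$-module of order indivisible by $\mathrm{char}\,F$, and $\mathscr{W}$ a compact open subgroup of the restricted product $\prod'_vH^1(G_v,M)$ with respect to the subgroups $H^1_{\mathrm{ur}}(G_v,M)$; morphisms $(M,\mathscr{W})\to(M',\mathscr{W}')$ are $G_F$-equivariant homomorphisms $f$ with $f(\mathscr{W})\subseteq\mathscr{W}'$. This is an additive category with all kernels and cokernels (preabelian). A sequence $0\to(M_1,\mathscr{W}_1)\xrightarrow{\iota}(M,\mathscr{W})\xrightarrow{\pi}(M_2,\mathscr{W}_2)\to0$ is short exact if the underlying sequence of $G_F$-modules is exact, $\iota^{-1}(\mathscr{W})=\mathscr{W}_1$ and $\pi(\mathscr{W})=\mathscr{W}_2$.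 Pullback of $E$ along $f\colon N_2\to M_2$: the sequence $0\to M_1\xrightarrow{\iota_N}N\xrightarrow{\pi_N}N_2\to0$, where $N$ is the fibre product (in $\mathrm{SMod}_F$) of $f$ and $\pi$, $\pi_N$ is its projection to $N_2$, and $\iota_N$ is the unique morphism whose composition with $N\to M$ is $\iota$ and whose composition with $\pi_N$ is $0$. Pushout of $E$ along $g\colon M_1\to N_1$: dually, the sequence $0\to N_1\to N\to M_2\to0$, where $N$ is the pushout (in $\mathrm{SMod}_F$) of $\iota$ and $g$, and $N\to M_2$ is the unique morphism restricting to $\pi$ on $M$ and to $0$ on $N_1$. *)

(* Defs.v *)
From HB Require Import structures.
From mathcomp Require Import all_boot all_order all_algebra.
From mathcomp Require Import generic_quotient ring_quotient separable.
From mathcomp Require Import boolp classical_sets functions cardinality reals.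
From mathcomp Require Import topology exp.

Set Implicit Arguments.
Unset Strict Implicit.
Unset Printing Implicit Defensive.

Import Order.TTheory GRing.Theory Num.Theory.

Local Open Scope quotient_scope.
Local Open Scope classical_set_scope.
Local Open Scope ring_scope.

Definition finite_extension (K L : fieldType) (i : {rmorphism K -> L}) : Prop :=
  exists s : seq L, forall x : L,
    exists c : 'I_(size s) -> K, x = \sum_k i (c k) * s`_k.

Definition global_field (F : fieldType) : Prop :=
  (exists i : {rmorphism rat -> F}, finite_extension i) \/
  (exists p : nat, prime p /\
     exists i : {rmorphism {fraction {poly 'F_p}} -> F}, finite_extension i).

Definition separably_closed (L : fieldType) : Prop :=
  forall p : {poly L}, separable_poly p -> (1 < size p)%N -> exists x, root p x.

Definition separable_closure (K L : fieldType) (i : {rmorphism K -> L}) : Prop :=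
  (forall x : L, exists p : {poly K},
     separable_poly p /\ root (map_poly i p) x) /\
  separably_closed L.

Lemma separable_split (L : fieldType) (p : {poly L}) :
  separably_closed L -> separable_poly p ->
  exists rs : seq L, p = lead_coef p *: \prod_(r <- rs) ('X - r%:P).
Proof.
move=> Lc; have [n] := ubnP (size p); elim: n p => // n IH p.
rewrite ltnS => sp seps.
have p0 : p != 0 by exact: separable_poly_neq0.
have [s1|s1] := leqP (size p) 1.
  exists [::]; rewrite big_nil; move/size1_polyC: s1 => ->.
  by rewrite lead_coefC alg_polyC.
have [x /factor_theorem[q pE]] := Lc p seps s1.
have q0 : q != 0 by apply: contraNneq p0 => q0; rewrite pE q0 mul0r.
have sq : separable_poly q.
  by apply: dvdp_separable seps; rewrite pE dvdp_mulr.
have szq : (size q < n)%N.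
  by apply: leq_trans sp; rewrite pE size_Mmonic ?monicXsubC // size_XsubC addn2.
have [rs qE] := IH q szq sq.
exists (x :: rs); rewrite big_cons pE lead_coefM lead_coefXsubC mulr1.
by rewrite {1}qE mulrC scalerAr.
Qed.

Record absval (R : realType) (K : fieldType) := AbsVal {
  absval_fun :> K -> R;
  absval_ge0 : forall x, 0 <= absval_fun x;
  absval_eq0 : forall x, absval_fun x = 0 <-> x = 0;
  absvalM : forall x y, absval_fun (x * y) = absval_fun x * absval_fun y;
  absvalD : forall x y, absval_fun (x + y) <= absval_fun x + absval_fun y }.

Definition nontrivial_absval (R : realType) (K : fieldType) (a : absval R K) :=
  exists x : K, x != 0 /\ a x != 1.

Definition nonarchimedean (R : realType) (K : fieldType) (a : absval R K) :=
  forall x y, a (x + y) <= Num.max (a x) (a y).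

Definition equiv_absval (R : realType) (K : fieldType) (a b : absval R K) :=
  exists s : R, 0 < s /\ forall x, b x = a x `^ s.

Record place (R : realType) (F : fieldType) := Place {
  place_set : set (absval R F);
  placeP : exists a : absval R F,
    nontrivial_absval a /\ place_set = [set b | equiv_absval a b] }.

HB.mixin Record isTopGroup G of Group G & Topological G := {
  mulg_continuous : continuous (fun xy : G * G => (xy.1 * xy.2)%g);
  invg_continuous : continuous (fun x : G => x^-1%g) }.

#[short(type="topGroupType")]
HB.structure Definition TopGroup := {G of isTopGroup G & Group G & Topological G}.

Record top_hom (H G : topGroupType) := TopHom {
  th_fun :> H -> G;
  thM : forall s t, th_fun (s * t)%g = (th_fun s * th_fun t)%g;
  th_cont : continuous th_fun }.

Record gmod (G : topGroupType) := GMod {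
  gm_sort :> finZmodType;
  gact : G -> gm_sort -> gm_sort;
  gact1 : forall m, gact 1%g m = m;
  gactM : forall s t m, gact (s * t)%g m = gact s (gact t m);
  gactD : forall s m n, gact s (m + n) = gact s m + gact s n;
  gact_discrete : forall m, open [set s | gact s m = m] }.

Arguments gact {G g}.

Lemma gactB G (M : gmod G) (s : G) (m n : M) :
  gact s (m - n) = gact s m - gact s n.
Proof. by apply/eqP; rewrite eq_sym subr_eq -gactD subrK. Qed.

Lemma gact0 G (M : gmod G) (s : G) : gact s (0 : M) = 0.
Proof. by rewrite -[X in gact s X](subrr 0) gactB subrr. Qed.

Record ghom (G : topGroupType) (M N : gmod G) := GHom {
  gh_fun :> M -> N;
  ghD : forall m n, gh_fun (m + n) = gh_fun m + gh_fun n;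
  gh_act : forall s m, gh_fun (gact s m) = gact s (gh_fun m) }.

Lemma ghB G (M N : gmod G) (f : ghom M N) m n : f (m - n) = f m - f n.
Proof. by apply/eqP; rewrite eq_sym subr_eq -ghD subrK. Qed.

Lemma gh0 G (M N : gmod G) (f : ghom M N) : f 0 = 0.
Proof. by rewrite -[X in f X](subrr 0) ghB subrr. Qed.

Section Restriction.
Variables (H G : topGroupType) (h : top_hom H G).

Lemma th1 : h 1%g = 1%g.
Proof. by apply: (@mulgI G (h 1%g)); rewrite -thM !mulg1. Qed.

Section Mod.
Variable M : gmod G.

Lemma gres_act1 (m : M) : gact (h 1%g) m = m.
Proof. by rewrite th1 gact1. Qed.

Lemma gres_actM s t (m : M) : gact (h (s * t)%g) m = gact (h s) (gact (h t) m).
Proof. by rewrite thM gactM. Qed.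

Lemma gres_discrete (m : M) : open [set s | gact (h s) m = m].
Proof.
apply: (@open_comp _ _ h [set s | gact s m = m]); last exact: gact_discrete.
by move=> s _; apply: th_cont.
Qed.

Definition gres : gmod H :=
  GMod gres_act1 gres_actM (fun s => @gactD G M (h s)) gres_discrete.
End Mod.

Definition ghom_res (M N : gmod G) (f : ghom M N) : ghom (gres M) (gres N) :=
  @GHom H (gres M) (gres N) f (ghD f) (fun s m => gh_act f (h s) m).
End Restriction.

Section H1.
Variables (G : topGroupType) (M : gmod G).

(* M is discrete: continuity says that every preimage is open *)
Definition is_cocycle (c : G -> M) : Prop :=
  (forall s t, c (s * t)%g = c s + gact s (c t)) /\
  (forall A : set M, open (c @^-1` A)).

Definition cocycle_pred : {pred G -> M} := fun c => `[< is_cocycle c >].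

Record Z1 := MkZ1 { z1_fun :> G -> M; z1P : z1_fun \in cocycle_pred }.

HB.instance Definition _ := [isSub for z1_fun].
HB.instance Definition _ := [Choice of Z1 by <:].

Lemma z1_cocycle (c : Z1) : is_cocycle c.
Proof. by apply/asboolP; exact: (z1P c). Qed.

Lemma open_preimage2 (c d : G -> M) (op : M -> M -> M) :
  (forall A : set M, open (c @^-1` A)) -> (forall A : set M, open (d @^-1` A)) ->
  forall A : set M, open ((fun s => op (c s) (d s)) @^-1` A).
Proof.
move=> oc od A.
rewrite (_ : _ @^-1` A =
   \bigcup_(p in [set p : M * M | A (op p.1 p.2)])
      ((c @^-1` [set p.1]) `&` (d @^-1` [set p.2]))).
  by apply: bigcup_open => p _; apply: openI.
apply/seteqP; split => s /=; first by move=> As; exists (c s, d s).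
by move=> [[x y] /= Axy [-> ->]].
Qed.

Lemma cocycle_zmod_closed : zmod_closed cocycle_pred.
Proof.
split.
  apply/asboolP; split => [s t|A].
    by rewrite /= gact0 addr0.
  rewrite (_ : _ @^-1` A = [set s | A 0]) //.
  have [A0|A0] := pselect (A 0).
    by rewrite (_ : [set _ | _] = setT) ?predeqE //; exact: openT.
  by rewrite (_ : [set _ | _] = set0) ?predeqE //; exact: open0.
move=> c d /asboolP[cM cO] /asboolP[dM dO]; apply/asboolP; split => [s t|].
  rewrite /GRing.add /GRing.opp /= cM dM gactB opprD.
  by rewrite addrACA.
exact: (@open_preimage2 c d (fun x y => x - y)).
Qed.

HB.instance Definition _ :=
  GRing.isZmodClosed.Build (G -> M) cocycle_pred cocycle_zmod_closed.
HB.instance Definition _ :=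
  GRing.SubChoice_isSubZmodule.Build (G -> M) cocycle_pred Z1 cocycle_zmod_closed.

Definition is_coboundary (c : Z1) : Prop :=
  exists m : M, forall s, c s = gact s m - m.

Definition B1 : {pred Z1} := fun c => `[< is_coboundary c >].

Lemma z1D (c d : Z1) s : (c + d) s = c s + d s.
Proof. by rewrite -[LHS]/(val (c + d) s) raddfD. Qed.
Lemma z1B (c d : Z1) s : (c - d) s = c s - d s.
Proof. by rewrite -[LHS]/(val (c - d) s) raddfB. Qed.
Lemma z10 s : (0 : Z1) s = 0.
Proof. by rewrite -[LHS]/(val (0 : Z1) s) raddf0. Qed.

Lemma B1_zmod_closed : zmod_closed B1.
Proof.
split; first by apply/asboolP; exists 0 => s; rewrite gact0 subrr z10.
move=> c d /asboolP[m cE] /asboolP[n dE]; apply/asboolP; exists (m - n) => s.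
by rewrite z1B cE dE gactB !opprD !opprK addrACA.
Qed.

HB.instance Definition _ := GRing.isZmodClosed.Build Z1 B1 B1_zmod_closed.

Definition H1 := Quotient.quot B1.
HB.instance Definition _ := GRing.Zmodule.on H1.
HB.instance Definition _ := EqQuotient.on H1.

Definition class1 (c : Z1) : H1 := \pi_(H1) c.

Lemma class1_eq (c d : Z1) : class1 c = class1 d <-> is_coboundary (c - d).
Proof.
rewrite /class1; split => [/eqmodP|cd].
  by rewrite /= Quotient.equivE => /asboolP.
by apply/eqmodP; rewrite /= Quotient.equivE; apply/asboolP.
Qed.

Lemma class1D c d : class1 (c + d) = class1 c + class1 d.
Proof. by rewrite /class1 [LHS]Quotient.pi_add. Qed.
Lemma class1_repr (x : H1) : class1 (repr x) = x.
Proof. exact: reprK. Qed.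
End H1.

Section H1map.
Variables (G : topGroupType) (M N : gmod G) (f : ghom M N).

Lemma Z1map_subproof (c : Z1 M) :
  (fun s => f (c s)) \in @cocycle_pred G N.
Proof.
have [cM cO] := z1_cocycle c; apply/asboolP; split => [s t|A].
  by rewrite cM ghD gh_act.
exact: (cO (f @^-1` A)).
Qed.

Definition Z1map (c : Z1 M) : Z1 N := MkZ1 (Z1map_subproof c).

Definition H1map (x : H1 M) : H1 N := class1 (Z1map (repr x)).

Lemma H1mapE c : H1map (class1 c) = class1 (Z1map c).
Proof.
have /class1_eq[m E] := class1_repr (class1 c).
apply/class1_eq; exists (f m) => s.
by rewrite z1B /= -ghB -z1B E ghB gh_act.
Qed.
End H1map.

Section H1res.
Variables (H G : topGroupType) (h : top_hom H G) (M : gmod G).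

Lemma Z1res_subproof (c : Z1 M) :
  (fun s => c (h s)) \in @cocycle_pred H (gres h M).
Proof.
have [cM cO] := z1_cocycle c; apply/asboolP; split => [s t|A].
  by rewrite thM cM.
apply: (@open_comp _ _ h (c @^-1` A)); last exact: cO.
by move=> s _; apply: th_cont.
Qed.

Definition Z1res (c : Z1 M) : Z1 (gres h M) := MkZ1 (Z1res_subproof c).

Definition H1res (x : H1 M) : H1 (gres h M) := class1 (Z1res (repr x)).

Lemma H1resE c : H1res (class1 c) = class1 (Z1res c).
Proof.
have /class1_eq[m E] := class1_repr (class1 c).
by apply/class1_eq; exists m => s; rewrite z1B /= -z1B E.
Qed.

Lemma H1resD x y : H1res (x + y) = H1res x + H1res y.
Proof.
rewrite -(class1_repr x) -(class1_repr y) -class1D !H1resE -class1D.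
congr class1; apply: val_inj; apply/funext => s.
rewrite -[LHS]/((repr x + repr y : Z1 M) (h s)).
by rewrite -[RHS]/((Z1res (repr x) + Z1res (repr y)) s) !z1D.
Qed.

Lemma H1res0 : H1res 0 = 0.
Proof. by apply: (@addrI _ (H1res 0)); rewrite -H1resD !addr0. Qed.

Lemma H1resN x : H1res (- x) = - H1res x.
Proof. by apply: (@addrI _ (H1res x)); rewrite -H1resD !subrr H1res0. Qed.
End H1res.

Lemma H1map0 (G : topGroupType) (M N : gmod G) (f : ghom M N) : H1map f 0 = 0.
Proof.
have -> : (0 : H1 M) = class1 0.
  by apply: (@addrI _ (class1 0)); rewrite -class1D !addr0.
rewrite H1mapE.
have -> : (0 : H1 N) = class1 0.
  by apply: (@addrI _ (class1 0)); rewrite -class1D !addr0.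
congr class1; apply: val_inj; apply/funext => s.
by rewrite -[LHS]/(f ((0 : Z1 M) s)) -[RHS]/((0 : Z1 N) s) !z10 gh0.
Qed.

Lemma H1res_map (H G : topGroupType) (h : top_hom H G) (M N : gmod G)
  (f : ghom M N) x : H1res h (H1map f x) = H1map (ghom_res h f) (H1res h x).
Proof.
rewrite -(class1_repr x) H1mapE !H1resE H1mapE; congr class1.
exact: val_inj.
Qed.

Section Gal.
Variables (K L : fieldType) (i : {rmorphism K -> L}).

Definition is_gal (s : L -> L) : Prop :=
  [/\ zmod_morphism s, monoid_morphism s, bijective s & forall x, s (i x) = i x].

Definition gal_pred : {pred L -> L} := fun s => `[< is_gal s >].

Record gal := MkGal { gal_fun :> L -> L; galP : gal_fun \in gal_pred }.

HB.instance Definition _ := [isSub for gal_fun].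
HB.instance Definition _ := [Choice of gal by <:].

Lemma gal_is_gal (s : gal) : is_gal s.
Proof. by apply/asboolP; exact: (galP s). Qed.

HB.instance Definition _ (s : gal) :=
  GRing.isZmodMorphism.Build L L (gal_fun s)
    (let: And4 h _ _ _ := gal_is_gal s in h).
HB.instance Definition _ (s : gal) :=
  GRing.isMonoidMorphism.Build L L (gal_fun s)
    (let: And4 _ h _ _ := gal_is_gal s in h).

Lemma gal_bij (s : gal) : bijective s.
Proof. by case: (gal_is_gal s). Qed.

Lemma gal_fix (s : gal) x : s (i x) = i x.
Proof. by case: (gal_is_gal s). Qed.

Lemma gal1_subproof : (@id L) \in gal_pred.
Proof. by apply/asboolP; split => //; exists id. Qed.

Definition gal1 : gal := MkGal gal1_subproof.

Lemma gal_mul_subproof (s t : gal) : (s \o t) \in gal_pred.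
Proof.
apply/asboolP; split => [x y||| x] /=.
- by rewrite !rmorphB.
- by split => [|x y] /=; rewrite ?rmorph1 ?rmorphM.
- exact: bij_comp (gal_bij s) (gal_bij t).
- by rewrite !gal_fix.
Qed.

Definition gal_mul (s t : gal) : gal := MkGal (gal_mul_subproof s t).

Lemma gal_inv_exists (s : gal) : {t : gal | cancel s t & cancel t s}.
Proof.
apply: cid2; have [g sK gK] := gal_bij s.
have sI := can_inj sK.
suff gG : g \in gal_pred by exists (MkGal gG).
apply/asboolP; split => [x y||| x] /=.
- by apply: sI; rewrite rmorphB /= !gK.
- by split => [|x y]; apply: sI; rewrite ?rmorphM /= !gK ?rmorph1.
- by exists s.
- by apply: sI; rewrite gK gal_fix.
Qed.

Definition gal_inv (s : gal) : gal := s2val (gal_inv_exists s).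

Lemma gal_invK (s : gal) : cancel s (gal_inv s).
Proof. exact: (s2valP (gal_inv_exists s)). Qed.
Lemma gal_Kinv (s : gal) : cancel (gal_inv s) s.
Proof. exact: (s2valP' (gal_inv_exists s)). Qed.

Lemma gal_mulA : associative gal_mul.
Proof. by move=> s t u; apply: val_inj. Qed.
Lemma gal_mul1 : left_id gal1 gal_mul.
Proof. by move=> s; apply: val_inj. Qed.
Lemma gal_mulr1 : right_id gal1 gal_mul.
Proof. by move=> s; apply: val_inj. Qed.
Lemma gal_mulV : left_inverse gal1 gal_inv gal_mul.
Proof. by move=> s; apply: val_inj; apply/funext => x /=; rewrite gal_invK. Qed.
Lemma gal_mulrV : right_inverse gal1 gal_inv gal_mul.
Proof. by move=> s; apply: val_inj; apply/funext => x /=; rewrite gal_Kinv. Qed.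

HB.instance Definition _ :=
  isGroup.Build gal gal_mulA gal_mul1 gal_mulr1 gal_mulV gal_mulrV.

Definition agree_on (e : seq L) (s : gal) : set gal :=
  [set t | {in e, forall x, t x = s x}].

Definition krull_open (U : set gal) : Prop :=
  forall s, U s -> exists e : seq L, agree_on e s `<=` U.

Lemma krull_openT : krull_open setT.
Proof. by move=> s _; exists [::]. Qed.

Lemma krull_openI : setI_closed krull_open.
Proof.
move=> U V oU oV s [/oU[d dU] /oV[e eV]]; exists (d ++ e) => t tP; split.
  by apply: dU => x xd; apply: tP; rewrite mem_cat xd.
by apply: eV => x xe; apply: tP; rewrite mem_cat xe orbT.
Qed.

Lemma krull_open_bigU (I : Type) (f : I -> set gal) :
  (forall j, krull_open (f j)) -> krull_open (\bigcup_j f j).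
Proof.
move=> of_ s [j _ /of_[e eP]]; exists e => t /eP ft; by exists j.
Qed.

HB.instance Definition _ :=
  isOpenTopological.Build gal krull_openT krull_openI krull_open_bigU.

Lemma gal_openE (U : set gal) : open U <-> krull_open U.
Proof. by []. Qed.

Lemma agree_on_nbhs (e : seq L) (s : gal) : nbhs s (agree_on e s).
Proof.
exists (agree_on e s); split => // t tP; exists e => u uP x xe.
by rewrite uP // tP.
Qed.

Lemma gal_nbhsP (s : gal) (U : set gal) :
  nbhs s U <-> exists e, agree_on e s `<=` U.
Proof.
split => [[V [oV Vs VU]]|[e eU]].
  by have [e eV] := oV s Vs; exists e; apply: subset_trans VU.
exact: filterS eU (agree_on_nbhs e s).
Qed.

Lemma gal_mulg_continuous :
  continuous (fun xy : gal * gal => (xy.1 * xy.2)%g).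
Proof.
move=> [s t] U /gal_nbhsP[e eU] /=.
exists (agree_on (map t e) s, agree_on e t) => /=.
  by split; exact: agree_on_nbhs.
move=> [s' t'] /= [s'P t'P]; apply: eU => x xe /=.
by rewrite t'P // s'P //; apply: map_f.
Qed.

Lemma gal_invg_continuous : continuous (fun x : gal => x^-1%g).
Proof.
move=> s U /gal_nbhsP[e eU]; apply/gal_nbhsP.
exists (map (gal_inv s) e) => t tP; apply: eU => x xe.
apply: (can_inj (gal_invK t)); rewrite [LHS]gal_Kinv.
by rewrite tP ?gal_Kinv //; apply: (map_f (gal_inv s)).
Qed.

HB.instance Definition _ :=
  isTopGroup.Build gal gal_mulg_continuous gal_invg_continuous.

End Gal.

Section Local.
Variables (R : realType) (F Fs : fieldType) (iota : {rmorphism F -> Fs}).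

(* The completion F_v, a separable closure F_v^s with the absolute value
   extending that of F_v, and an embedding F^s -> F_v^s over F -> F_v *)
Record local_data (v : place R F) := LocalData {
  compl : fieldType;
  compl_emb : {rmorphism F -> compl};
  compl_abs : absval R compl;
  compl_place : exists a : absval R F,
    place_set v a /\ forall x, compl_abs (compl_emb x) = a x;
  compl_dense : forall (y : compl) (e : R), 0 < e ->
    exists x : F, compl_abs (y - compl_emb x) < e;
  compl_complete : forall u : nat -> compl,
    (forall e : R, 0 < e -> exists N, forall m n : nat,
       (N <= m)%N -> (N <= n)%N -> compl_abs (u m - u n) < e) ->
    exists l, forall e : R, 0 < e -> exists N, forall n : nat,
       (N <= n)%N -> compl_abs (u n - l) < e;
  compl_sep : fieldType;
  compl_sep_emb : {rmorphism compl -> compl_sep};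
  compl_sepP : separable_closure compl_sep_emb;
  compl_sep_abs : absval R compl_sep;
  compl_sep_absE : forall x, compl_sep_abs (compl_sep_emb x) = compl_abs x;
  sep_emb : {rmorphism Fs -> compl_sep};
  sep_embE : forall x, sep_emb (iota x) = compl_sep_emb (compl_emb x) }.

Variable iotaP : separable_closure iota.

Section AtPlace.
Variables (v : place R F) (D : local_data v).

Notation local_gal := (gal (compl_sep_emb D)).

Lemma gal_stable (s : local_gal) (x : Fs) :
  exists y : Fs, sep_emb D y = s (sep_emb D x).
Proof.
have [p [ps px]] := iotaP.1 x.
have [rs pE] : exists rs : seq Fs, map_poly iota p
    = lead_coef (map_poly iota p) *: \prod_(r <- rs) ('X - r%:P).
  by apply: separable_split iotaP.2 _; rewrite separable_map.
set q := map_poly (sep_emb D) (map_poly iota p).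
have p0 : lead_coef (map_poly iota p) != 0.
  by rewrite lead_coef_eq0 map_poly_eq0; exact: separable_poly_neq0.
have qs : map_poly s q = q.
  rewrite /q -!map_poly_comp; apply: eq_map_poly => a /=.
  by rewrite !sep_embE gal_fix.
have : root q (s (sep_emb D x)) by rewrite -qs fmorph_root /q fmorph_root.
rewrite /q pE linearZ /= rootZ; last by rewrite fmorph_eq0.
rewrite rmorph_prod /=.
under eq_bigr do rewrite map_polyXsubC.
rewrite -(big_map (sep_emb D) xpredT (fun r => 'X - r%:P)) root_prod_XsubC.
by move=> /mapP[y _ ->]; exists y.
Qed.

Definition res_fun (s : local_gal) (x : Fs) : Fs := sval (cid (gal_stable s x)).

Lemma res_funE s x : sep_emb D (res_fun s x) = s (sep_emb D x).
Proof. exact: (svalP (cid (gal_stable s x))). Qed.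

Lemma res_funM s t : res_fun (s * t)%g = res_fun s \o res_fun t.
Proof.
by apply/funext => x; apply: (fmorph_inj (sep_emb D)); rewrite /= !res_funE.
Qed.

Lemma res_fun1 : res_fun 1%g = id.
Proof.
by apply/funext => x; apply: (fmorph_inj (sep_emb D)); rewrite /= !res_funE.
Qed.

Lemma res_subproof (s : local_gal) : res_fun s \in gal_pred iota.
Proof.
have eI := fmorph_inj (sep_emb D).
apply/asboolP; split => [x y|||x].
- by apply: eI; rewrite rmorphB !res_funE !rmorphB.
- split => [|x y]; apply: eI; first by rewrite res_funE !rmorph1.
  by rewrite rmorphM !res_funE !rmorphM.
- exists (res_fun s^-1%g) => x.
    by rewrite -[LHS]/((res_fun s^-1%g \o res_fun s) x) -res_funM mulVg res_fun1.
  by rewrite -[LHS]/((res_fun s \o res_fun s^-1%g) x) -res_funM mulgV res_fun1.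
- by apply: eI; rewrite res_funE !sep_embE gal_fix.
Qed.

Definition res_gal (s : local_gal) : gal iota := MkGal (res_subproof s).

Lemma res_galM s t : res_gal (s * t)%g = (res_gal s * res_gal t)%g.
Proof. by apply: val_inj => /=; rewrite res_funM. Qed.

Lemma res_gal_continuous : continuous res_gal.
Proof.
move=> s U /gal_nbhsP[e eU]; apply/gal_nbhsP.
exists (map (sep_emb D) e) => t tP; apply: eU => x xe /=.
by apply: (fmorph_inj (sep_emb D)); rewrite !res_funE tP //; apply: map_f.
Qed.

(* The inclusion of G_v in G_F: restriction along F^s -> F_v^s *)
Definition decomp : top_hom local_gal (gal iota) :=
  TopHom res_galM res_gal_continuous.

(* For nonarchimedean v, the automorphisms preserving the valuation ring of
   F_v^s and acting trivially on its residue field; all of G_v otherwise.  The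
   first condition is automatic, the extension of the absolute value to F_v^s
   being unique; stating it makes inertia a group without proving that.  An
   extension of an absolute value is archimedean iff the original one is. *)
Definition is_inertia (s : local_gal) : Prop :=
  nonarchimedean (compl_sep_abs D) ->
  (forall x, (compl_sep_abs D (s x) <= 1) = (compl_sep_abs D x <= 1)) /\
  (forall x, compl_sep_abs D x <= 1 -> compl_sep_abs D (s x - x) < 1).

Definition inertia_pred : {pred local_gal} := fun s => `[< is_inertia s >].

Record inertia := MkInertia {
  inertia_gal :> local_gal; inertiaP : inertia_gal \in inertia_pred }.

HB.instance Definition _ := [isSub for inertia_gal].
HB.instance Definition _ := [Choice of inertia by <:].

Lemma absval0 (K : fieldType) (a : absval R K) : a 0 = 0.
Proof. exact/absval_eq0. Qed.

Lemma absvalN (K : fieldType) (a : absval R K) x : a (- x) = a x.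
Proof.
have aN1 : a (-1) = 1.
  have a1 : a 1 = 1.
    have a1n0 : a 1 != 0.
      by apply/eqP => /absval_eq0/eqP; rewrite oner_eq0.
    by apply: (mulfI a1n0); rewrite -absvalM !mulr1.
  have := absvalM a (-1) (-1); rewrite mulrNN mulr1 a1 => /esym/eqP.
  rewrite -expr2 sqrf_eq1 => /orP[/eqP//|/eqP aN].
  by have := absval_ge0 a (-1); rewrite aN oppr_ge0 ler10.
by rewrite -mulN1r absvalM aN1 mul1r.
Qed.

Lemma inertia_group_closed : group_closed inertia_pred.
Proof.
split; first by apply/asboolP => _; split => // x; rewrite subrr absval0 ltr01.
move=> s t /asboolP sI /asboolP tI; apply/asboolP => na.
have [s1 s2] := sI na; have [t1 t2] := tI na.
have tV x : t (t^-1%g x) = x by exact: gal_Kinv.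
have V1 x : (compl_sep_abs D (t^-1%g x) <= 1) = (compl_sep_abs D x <= 1).
  by rewrite -t1 tV.
split => x; first by rewrite -[LHS]/(compl_sep_abs D (s (t^-1%g x)) <= 1) s1 V1.
rewrite -V1 => x1; rewrite -[X in X - x]/(s (t^-1%g x)).
rewrite -(subrKA (t^-1%g x)) (le_lt_trans (na _ _)) // gt_max s2 //=.
by rewrite -absvalN opprB -{1}[x]tV t2.
Qed.

HB.instance Definition _ :=
  SubChoice_isSubGroup.Build local_gal inertia_pred inertia inertia_group_closed.
HB.instance Definition _ :=
  Topological.copy inertia (initial_topology inertia_gal).

Lemma inertia_openP (U : set inertia) :
  open U <-> exists2 V : set local_gal, open V & inertia_gal @^-1` V = U.
Proof. by []. Qed.

Lemma inertia_galM (s t : inertia) :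
  inertia_gal (s * t)%g = (inertia_gal s * inertia_gal t)%g.
Proof. exact: (valM s t). Qed.

Lemma inertia_galV (s : inertia) : inertia_gal s^-1%g = (inertia_gal s)^-1%g.
Proof.
by apply: (@mulgI local_gal (inertia_gal s)); rewrite -inertia_galM !mulgV.
Qed.

Lemma inertia_gal_continuous : continuous inertia_gal.
Proof. exact: initial_continuous. Qed.

Lemma inertia_nbhsP (s : inertia) (U : set inertia) :
  nbhs s U <-> exists2 V : set local_gal,
    nbhs (inertia_gal s) V & inertia_gal @^-1` V `<=` U.
Proof.
split => [|[V sV VU]].
  rewrite nbhsE => -[W [/inertia_openP[V oV <-] sV] WU].
  by exists V => //; exact: open_nbhs_nbhs.
exact: filterS VU (inertia_gal_continuous sV).
Qed.

Lemma inertia_mulg_continuous :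
  continuous (fun xy : inertia * inertia => (xy.1 * xy.2)%g).
Proof.
move=> [s t] U /inertia_nbhsP[V stV VU] /=.
have := @mulg_continuous local_gal (inertia_gal s, inertia_gal t) V.
rewrite /= -inertia_galM => /(_ stV)[[A B] /= [sA tB] AB].
exists (inertia_gal @^-1` A, inertia_gal @^-1` B) => /=.
  by split; [exact: inertia_gal_continuous sA|exact: inertia_gal_continuous tB].
move=> [s' t'] /= [s'A t'B]; apply: VU.
rewrite -[_ _]/(V (inertia_gal (s' * t')%g)) inertia_galM; exact: (AB (inertia_gal s', inertia_gal t')).
Qed.

Lemma inertia_invg_continuous : continuous (fun x : inertia => x^-1%g).
Proof.
move=> s U /inertia_nbhsP[V sV VU].
have := @invg_continuous local_gal (inertia_gal s) V.
rewrite -inertia_galV => /(_ sV) sV'.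
have : nbhs s (inertia_gal @^-1` ((fun x => x^-1%g) @^-1` V)).
  exact: inertia_gal_continuous sV'.
apply: (@filterS _ (nbhs s)) => t tV.
by apply: VU; rewrite -[_ _]/(V (inertia_gal t^-1%g)) inertia_galV.
Qed.

HB.instance Definition _ :=
  isTopGroup.Build inertia inertia_mulg_continuous inertia_invg_continuous.

Definition inertia_incl : top_hom inertia local_gal :=
  TopHom inertia_galM inertia_gal_continuous.

Definition H1v (M : gmod (gal iota)) := H1 (gres decomp M).
HB.instance Definition _ (M : gmod (gal iota)) := GRing.Zmodule.on (H1v M).

Definition H1ur (M : gmod (gal iota)) : set (H1v M) :=
  [set x | H1res inertia_incl x = 0].
Arguments H1ur M : clear implicits.

Definition H1v_map (M N : gmod (gal iota)) (f : ghom M N) : H1v M -> H1v N :=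
  H1map (ghom_res decomp f).

Lemma H1ur0 M : H1ur M 0.
Proof. exact: H1res0. Qed.

Lemma H1urD M x y : H1ur M x -> H1ur M y -> H1ur M (x + y).
Proof. by rewrite /H1ur /= => x0 y0; rewrite [LHS]H1resD x0 y0 addr0. Qed.

Lemma H1urN M x : H1ur M x -> H1ur M (- x).
Proof. by rewrite /H1ur /= => x0; rewrite [LHS]H1resN x0 oppr0. Qed.

Lemma H1ur_map M N (f : ghom M N) x : H1ur M x -> H1ur N (H1v_map f x).
Proof. by rewrite /H1ur /= => x0; rewrite H1res_map x0 H1map0. Qed.

End AtPlace.

Arguments H1v {v} D M.
Arguments H1ur {v} D M.
Arguments H1v_map {v} D {M N} f.

Variable D : forall v : place R F, local_data v.

Section RestrictedProduct.
Variable M : gmod (gal iota).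

Definition rprod_pred : {pred forall v, H1v (D v) M} :=
  fun x => `[< finite_set [set v | ~ H1ur (D v) M (x v)] >].

Record rprod := MkRprod {
  rprod_fun :> forall v, H1v (D v) M; rprodP : rprod_fun \in rprod_pred }.

HB.instance Definition _ := [isSub for rprod_fun].
HB.instance Definition _ := [Choice of rprod by <:].

Lemma rprod_finite (x : rprod) : finite_set [set v | ~ H1ur (D v) M (x v)].
Proof. by apply/asboolP; exact: (rprodP x). Qed.

Lemma rprod_ext (x y : rprod) : (forall v, x v = y v) -> x = y.
Proof. by move=> xy; apply: val_inj; apply: functional_extensionality_dep. Qed.

Lemma rprod0_subproof : (fun v => 0 : H1v (D v) M) \in rprod_pred.
Proof.
apply/asboolP; rewrite (_ : [set _ | _] = set0) //.
by apply/seteqP; split => // v /=; apply; exact: H1ur0.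
Qed.

Lemma rprodD_subproof (x y : rprod) : (fun v => x v + y v) \in rprod_pred.
Proof.
apply/asboolP; apply: sub_finite_set (_ : finite_set
  ([set v | ~ H1ur (D v) M (x v)] `|` [set v | ~ H1ur (D v) M (y v)])).
  move=> v /= nxy; apply: contrapT => /not_orP[/contrapT xv /contrapT yv].
  by apply: nxy; exact: H1urD.
by rewrite finite_setU; split; exact: rprod_finite.
Qed.

Lemma rprodN_subproof (x : rprod) : (fun v => - x v) \in rprod_pred.
Proof.
apply/asboolP; apply: sub_finite_set (rprod_finite x) => v /= nx xv.
by apply: nx; exact: H1urN.
Qed.

Definition rprod0 := MkRprod rprod0_subproof.
Definition rprodD x y := MkRprod (rprodD_subproof x y).
Definition rprodN x := MkRprod (rprodN_subproof x).

Lemma rprodDA : associative rprodD.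
Proof. by move=> x y z; apply: rprod_ext => v /=; rewrite addrA. Qed.
Lemma rprodDC : commutative rprodD.
Proof. by move=> x y; apply: rprod_ext => v /=; rewrite addrC. Qed.
Lemma rprodD0 : left_id rprod0 rprodD.
Proof. by move=> x; apply: rprod_ext => v /=; rewrite add0r. Qed.
Lemma rprodDN : left_inverse rprod0 rprodN rprodD.
Proof. by move=> x; apply: rprod_ext => v /=; rewrite addNr. Qed.

HB.instance Definition _ :=
  GRing.isZmodule.Build rprod rprodDA rprodDC rprodD0 rprodDN.

(* A box with open factors (each H^1(G_v, M) being discrete, any subset is
   open), equal to H^1_ur outside a finite set of places *)
Definition is_basic (U : forall v, set (H1v (D v) M)) : Prop :=
  finite_set [set v | U v <> H1ur (D v) M].

Definition box (U : forall v, set (H1v (D v) M)) : set rprod :=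
  [set x | forall v, U v (x v)].

Definition rprod_open (O : set rprod) : Prop :=
  forall x, O x -> exists U, [/\ is_basic U, box U x & box U `<=` O].

Lemma rprod_openT : rprod_open setT.
Proof.
move=> x _; exists (fun v => H1ur (D v) M `|` [set x v]).
split => //; last by move=> v; right.
apply: sub_finite_set (rprod_finite x) => v /= nU xv; apply: nU.
by apply/seteqP; split => y //=; [move=> [//|->]|left].
Qed.

Lemma rprod_openI : setI_closed rprod_open.
Proof.
move=> O P oO oP x [/oO[U [bU Ux UO]] /oP[V [bV Vx VP]]].
exists (fun v => U v `&` V v); split.
- apply: sub_finite_set (_ : finite_set
    ([set v | U v <> H1ur (D v) M] `|` [set v | V v <> H1ur (D v) M])).
    move=> v /= nUV; apply: contrapT => /not_orP[/contrapT Uv /contrapT Vv].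
    by apply: nUV; rewrite Uv Vv setIid.
  by rewrite finite_setU.
- by move=> v; split.
- by move=> y yUV; split; [apply: UO|apply: VP] => v; have [] := yUV v.
Qed.

Lemma rprod_open_bigU (I : Type) (f : I -> set rprod) :
  (forall j, rprod_open (f j)) -> rprod_open (\bigcup_j f j).
Proof.
move=> of_ x [j _ /of_[U [bU Ux Uf]]]; exists U; split => //.
by move=> y /Uf fy; exists j.
Qed.

HB.instance Definition _ :=
  isOpenTopological.Build rprod rprod_openT rprod_openI rprod_open_bigU.

End RestrictedProduct.

Section RprodMap.
Variables (M N : gmod (gal iota)) (f : ghom M N).

Lemma rprod_map_subproof (x : rprod M) :
  (fun v => H1v_map (D v) f (x v)) \in @rprod_pred N.
Proof.
apply/asboolP; apply: sub_finite_set (rprod_finite x) => v /= nx xv.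
by apply: nx; exact: H1ur_map.
Qed.

Definition rprod_map (x : rprod M) : rprod N := MkRprod (rprod_map_subproof x).
End RprodMap.

Record SMod := MkSMod {
  smod :> gmod (gal iota);
  smod_order : forall p, p \in [pchar F] -> ~~ (p %| #|smod|)%N;
  selmer : set (rprod smod);
  selmer0 : selmer 0;
  selmerB : forall x y, selmer x -> selmer y -> selmer (x - y);
  selmer_open : open selmer;
  selmer_compact : compact selmer }.
Arguments selmer M : clear implicits, rename.

Record shom (M N : SMod) := SHom {
  shom_fun :> ghom M N;
  shom_selmer : rprod_map shom_fun @` selmer M `<=` selmer N }.

Definition short_exact (M1 M M2 : SMod) (i : shom M1 M) (p : shom M M2) : Prop :=
  [/\ injective i,
      range i = [set x | p x = 0],
      range p = setT,
      rprod_map i @^-1` selmer M = selmer M1 &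
      rprod_map p @` selmer M = selmer M2].

Definition is_fibre_product (M N2 M2 : SMod) (p : shom M M2) (f : shom N2 M2)
    (N : SMod) (q : shom N M) (r : shom N N2) : Prop :=
  (forall x, p (q x) = f (r x)) /\
  forall (T : SMod) (a : shom T M) (b : shom T N2),
    (forall t, p (a t) = f (b t)) ->
    exists h : shom T N,
      [/\ forall t, q (h t) = a t,
          forall t, r (h t) = b t &
          forall h' : shom T N, (forall t, q (h' t) = a t) ->
            (forall t, r (h' t) = b t) -> forall t, h' t = h t].

Definition is_pushout (M1 M N1 : SMod) (i : shom M1 M) (g : shom M1 N1)
    (N : SMod) (q : shom M N) (r : shom N1 N) : Prop :=
  (forall x, q (i x) = r (g x)) /\
  forall (T : SMod) (a : shom M T) (b : shom N1 T),
    (forall x, a (i x) = b (g x)) ->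
    exists h : shom N T,
      [/\ forall x, h (q x) = a x,
          forall x, h (r x) = b x &
          forall h' : shom N T, (forall x, h' (q x) = a x) ->
            (forall x, h' (r x) = b x) -> forall y, h' y = h y].

Definition is_pullback_seq (M1 M M2 N2 : SMod) (i : shom M1 M) (p : shom M M2)
    (f : shom N2 M2) (N : SMod) (iN : shom M1 N) (pN : shom N N2) : Prop :=
  exists q : shom N M,
    [/\ is_fibre_product p f q pN,
        forall x, q (iN x) = i x & forall x, pN (iN x) = 0].

Definition is_pushout_seq (M1 M M2 N1 : SMod) (i : shom M1 M) (p : shom M M2)
    (g : shom M1 N1) (N : SMod) (iN : shom N1 N) (pN : shom N M2) : Prop :=
  exists q : shom M N,
    [/\ is_pushout i g q iN,
        forall x, pN (q x) = p x & forall x, pN (iN x) = 0].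

End Local.

(* Main.v *)
Require Import Defs.
From HB Require Import structures.
From mathcomp Require Import all_boot all_order all_algebra.
From mathcomp Require Import generic_quotient ring_quotient separable finfield.
From mathcomp Require Import boolp classical_sets functions cardinality reals.
From mathcomp Require Import topology normedtype sequences exp.
From mathcomp Require Import finmap ring lra zify.

Set Implicit Arguments.
Unset Strict Implicit.
Unset Printing Implicit Defensive.

Import Order.TTheory GRing.Theory Num.Theory.
Import numFieldNormedType.Exports.

Local Open Scope quotient_scope.
Local Open Scope classical_set_scope.
Local Open Scope ring_scope.

(* The fibre product and the pushout are those of Galois modules, with Selmer
   groups { z | z maps into W and into W_2 } and { q(w) + j(w_1) }.

   Why these are compact and open: a finite extension of Q or F_p(t) has
   finitely many places over each place of the base (by weak approximation,
   inequivalent absolute values with the same restriction to the base produce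
   linearly independent elements), so every element of F^s is integral at almost
   all places, and hence inertia acts trivially on a finite module at almost all
   places.  There, maps which are jointly injective on modules reflect unramified
   classes.  Moreover an open subgroup of the restricted product is compact
   exactly when it lies in a box with finite factors, unramified almost
   everywhere.

   Exactness is a cocycle computation at each place, glued by the same
   reflection of unramified classes.  No second cohomology is needed for the
   pushout: that unramified classes of N come from M and N_1 at almost all places
   follows from pi(W) = W_2. *)

(** * Absolute values and places *)

(** An injection of modules need not stay injective on [H^1], and this shapes the pushout half.
    Proving that the preimage of the new Selmer group is that of [N1] means controlling the kernel
    of [H^1(j)] for [j : N1 -> N]. That kernel consists of images under [g] of classes killed by
    [i], and these belong to the Selmer group of [M1] because it is the full preimage of the one of
    [M]. All local lifting uses one device: after a shift by a coboundary the lift exists pointwise,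
    and a pointwise lift through jointly injective maps is automatically a continuous cocycle.
    Openness in the pushout comes from cutting elements off to zero on a finite set of places, an
    operation that commutes with all maps and lands in known open subgroups. Places are compared
    only through their unit balls on the base field. For archimedean places this takes monotonicity
    on the natural numbers, for the others a Bezout relation and finite residue rings, or the degree
    at infinity. Both universal constructions are unique up to an isomorphism of Selmer modules, so
    exactness is checked on one model and transported. *)

Lemma bernoulli_le (R : realDomainType) (e : R) n :
  0 <= e -> 1 + n%:R * e <= (1 + e) ^+ n.
Proof.
move=> e0; elim: n => [|n IH]; first by rewrite mul0r addr0 expr0.
rewrite exprS; apply: le_trans (_ : (1 + e) * (1 + n%:R * e) <= _).
  rewrite -natr1; have : 0 <= n%:R * e * e by rewrite !mulr_ge0.
  nra.
by rewrite ler_wpM2l // addr_ge0.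
Qed.

(** Exponential growth beats linear growth. This is what removes polynomial factors whenever an
    inequality is applied to all powers at once. *)
Lemma le1_of_expr_le (R : realType) (x c : R) :
  0 <= x -> (forall n, x ^+ n <= c * n.+1%:R) -> x <= 1.
Proof.
move=> x0 xc; rewrite leNgt; apply/negP => x1.
pose e := x - 1; have e0 : 0 < e by rewrite subr_gt0.
have c0 : 0 < c by have := xc 0%N; rewrite expr0 mulr1; lra.
(* With exponent [2m], Bernoulli gives the quadratic lower bound [(m e)^2], while the hypothesis
   gives [c (2m + 1)], at most [3 c m]; this [m] makes them incompatible. *)
have [m mP] : exists m : nat, 3 * c / e ^+ 2 < m%:R.
  by exists (Num.truncn (3 * c / e ^+ 2)).+1; rewrite truncnS_gt.
have m0 : (0 < m)%N.
  rewrite -(ltr_nat R); apply: le_lt_trans mP.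
  by rewrite divr_ge0 ?sqr_ge0 ?mulr_ge0 ?ltW.
have mR : 1 <= m%:R :> R by rewrite (ler_nat _ 1).
have := xc (m * 2)%N; rewrite exprM.
have h : m%:R * e <= x ^+ m.
  have := bernoulli_le m (ltW e0); rewrite (_ : 1 + e = x); last by rewrite /e; lra.
  lra.
have h2 : (m%:R * e) ^+ 2 <= (x ^+ m) ^+ 2.
  by rewrite ler_sqr // nnegrE ?mulr_ge0 ?exprn_ge0 // ltW.
have h3 : 3 * c < m%:R * e ^+ 2.
  by rewrite -ltr_pdivrMr // exprn_gt0.
have h4 : 3 * c * m%:R < (m%:R * e) ^+ 2.
  rewrite (_ : (m%:R * e) ^+ 2 = m%:R * e ^+ 2 * m%:R); last by ring.
  by rewrite ltr_pM2r // ltr0n.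
have -> : (m * 2).+1%:R = 2 * m%:R + 1 :> R by rewrite -natr1 natrM mulrC.
nra.
Qed.

Section AbsValTheory.
Variables (R : realType) (K : fieldType).
Implicit Types a b : absval R K.

Lemma absval1 a : a 1 = 1.
Proof.
have a1n0 : a 1 != 0 by apply/eqP => /absval_eq0/eqP; rewrite oner_eq0.
by apply: (mulfI a1n0); rewrite -absvalM !mulr1.
Qed.

Lemma absvalX a x n : a (x ^+ n) = a x ^+ n.
Proof. by elim: n => [|n IH]; rewrite ?expr0 ?absval1 // !exprS absvalM IH. Qed.

Lemma absval_eq0b a x : (a x == 0) = (x == 0).
Proof. by apply/eqP/eqP; case: (absval_eq0 a x). Qed.

Lemma absval_gt0 a x : (0 < a x) = (x != 0).
Proof. by rewrite lt0r absval_ge0 andbT absval_eq0b. Qed.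

Lemma absvalV a x : a x^-1 = (a x)^-1.
Proof.
have [->|x0] := eqVneq x 0; first by rewrite invr0 absval0 invr0.
have ax0 : a x != 0 by rewrite absval_eq0b.
by apply: (mulfI ax0); rewrite -absvalM !divff // absval1.
Qed.

Lemma absval_div a x y : a (x / y) = a x / a y.
Proof. by rewrite absvalM absvalV. Qed.

Lemma absval_sum a (I : Type) (r : seq I) (P : pred I) (f : I -> K) :
  a (\sum_(k <- r | P k) f k) <= \sum_(k <- r | P k) a (f k).
Proof.
elim/big_rec2: _ => [|k x y _ h]; first by rewrite absval0.
by apply: le_trans (absvalD _ _ _) _; rewrite lerD2l.
Qed.

Lemma absval_nat_le a n : a n%:R <= n%:R.
Proof.
elim: n => [|n IH]; first by rewrite absval0.
rewrite -natr1 -[in leRHS]natr1; apply: le_trans (absvalD _ _ _) _.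
by rewrite absval1 lerD2r.
Qed.

(** The binomial theorem bounds [a (x + y) ^+ n] by [n + 1] times the [n]-th power of the maximum,
    and the linear factor disappears by [le1_of_expr_le]. *)
Lemma nonarchimedean_nat a : (forall n, a n%:R <= 1) -> nonarchimedean a.
Proof.
move=> an x y; set M := Num.max _ _.
have M0 : 0 <= M by rewrite le_max absval_ge0.
have [ME|Mn0] := eqVneq M 0.
  have : a x <= M /\ a y <= M by rewrite /M !le_max !lexx orbT.
  by case; have := absvalD a x y; lra.
have Mgt : 0 < M by rewrite lt0r Mn0.
suff : a (x + y) / M <= 1 by rewrite ler_pdivrMr // mul1r.
apply: (@le1_of_expr_le R _ 1); first by rewrite divr_ge0 ?absval_ge0.
move=> n; rewrite mul1r expr_div_n ler_pdivrMr ?exprn_gt0 // -absvalX exprDn.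
apply: le_trans (absval_sum _ _ _ _) _.
apply: le_trans (_ : _ <= \sum_(k < n.+1) M ^+ n) _; last first.
  by rewrite sumr_const card_ord mulr_natl.
apply: ler_sum => k _; rewrite -mulr_natr !absvalM !absvalX.
apply: le_trans (_ : a x ^+ (n - k) * a y ^+ k <= _).
  by rewrite ler_piMr // mulr_ge0 ?exprn_ge0 ?absval_ge0.
rewrite (_ : M ^+ n = M ^+ (n - k) * M ^+ k); last first.
  by rewrite -exprD subnK // -ltnS.
rewrite ler_pM ?exprn_ge0 ?absval_ge0 // lerXn2r ?nnegrE ?absval_ge0 //.
  by rewrite le_max lexx.
by rewrite le_max lexx orbT.
Qed.

Lemma nonarchimedean_sum a (I : Type) (r : seq I) (P : pred I) (f : I -> K) B :
  nonarchimedean a -> 0 <= B -> (forall k, P k -> a (f k) <= B) ->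
  a (\sum_(k <- r | P k) f k) <= B.
Proof.
move=> na B0 fB; elim/big_ind: _ => [|x y xB yB|//]; first by rewrite absval0.
by apply: le_trans (na _ _) _; rewrite ge_max xB.
Qed.

(** Were [a x > 1], the leading monomial would strictly exceed every other one, although it is the
    negative of their sum. *)
Lemma absval_integral a (p : {poly K}) x :
  nonarchimedean a -> p \is monic -> (forall k, a p`_k <= 1) -> root p x ->
  a x <= 1.
Proof.
move=> na pm pk /rootP px; rewrite leNgt; apply/negP => x1.
have sp : (0 < size p)%N by rewrite size_poly_gt0 monic_neq0.
have := px; rewrite horner_coef; case nE: (size p) sp => [|n] // _.
rewrite big_ord_recr /= => /eqP.
have -> : p`_n = 1 by move/eqP: pm; rewrite lead_coefE nE.
rewrite mul1r addrC addr_eq0 => /eqP xn.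
have [n0|n0] := posnP n.
  move: xn; rewrite n0 expr0 big_ord0 oppr0 => /eqP; by rewrite oner_eq0.
have : a (x ^+ n) <= a x ^+ n.-1.
  rewrite xn absvalN; apply: nonarchimedean_sum => //.
    by rewrite exprn_ge0 // absval_ge0.
  move=> k _; rewrite absvalM absvalX.
  apply: le_trans (_ : a x ^+ k <= _).
    by rewrite ler_piMl ?exprn_ge0 ?absval_ge0.
  by rewrite ler_weXn2l ?(ltW x1) // -ltnS prednK.
rewrite absvalX -{1}(prednK n0) exprS leNgt => /negP; apply.
by rewrite ltr_pMl // exprn_gt0 // (lt_trans _ x1).
Qed.

Lemma expr_lt_near (r e : R) : 0 <= r < 1 -> 0 < e -> \forall n \near \oo, r ^+ n < e.
Proof.
move=> /andP[r0 r1] e0.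
have /cvg_expr h : `|r| < 1 by rewrite ger0_norm.
near=> n; apply: le_lt_trans (ler_norm _) _; near: n.
exact: cvgr0_norm_lt _ h e e0.
Unshelve. all: by end_near. Qed.

Lemma absval_div_1D_le a x : a x < 1 -> a (x / (1 + x)) <= a x / (1 - a x).
Proof.
move=> x1; have h : 1 - a x <= a (1 + x).
  by have := absvalD a (1 + x) (- x); rewrite addrK absvalN absval1; lra.
have h0 : 0 < 1 - a x by rewrite subr_gt0.
rewrite absval_div ler_wpM2l ?absval_ge0 // lef_pV2 // posrE //.
exact: lt_le_trans h.
Qed.

Lemma absval_1D_bounds a x : 1 < a x ->
  a x / (1 + a x) <= a (x / (1 + x)) /\ a (x / (1 + x)) <= a x / (a x - 1).
Proof.
move=> x1.
have h : a x - 1 <= a (1 + x).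
  by have := absvalD a (1 + x) (- 1); rewrite [1 + x]addrC addrK absvalN absval1; lra.
have h' : a (1 + x) <= 1 + a x by have := absvalD a 1 x; rewrite absval1.
have h0 : 0 < a x - 1 by rewrite subr_gt0.
have h1 : 0 < a (1 + x) by exact: lt_le_trans h.
rewrite absval_div; split; rewrite ler_wpM2l ?absval_ge0 // lef_pV2 // posrE //.
exact: lt_le_trans h'.
Qed.

Definition separated a b := exists x, 1 < a x /\ b x < 1.

(* x^m / (1 + x^m) tends to 1 where |x| > 1 and to 0 where |x| < 1. *)
Lemma separated_family a (c : nat -> absval R K) n :
  nontrivial_absval a -> (forall j, (j < n)%N -> separated a (c j)) ->
  exists x, 1 < a x /\ forall j, (j < n)%N -> c j x < 1.
Proof.
move=> [z [z0 az]]; elim: n => [|n IH] sep.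
  have [az1|az1] := ltP 1 (a z); first by exists z.
  exists z^-1; split => //; rewrite absvalV invf_gt1 ?absval_gt0 //.
  by rewrite lt_neqAle az.
have [x [x1 xc]] : exists x, 1 < a x /\ forall j, (j < n)%N -> c j x < 1.
  by apply: IH => j jn; apply: sep; exact: ltnW.
have [y [y1 yc]] := sep n (ltnSn n).
have y0 : y != 0 by rewrite -(absval_gt0 a) (lt_trans _ y1).
have cy0 j : 0 < c j y by rewrite absval_gt0.
(* If [c n x <= 1], the product [x^m y] works for large [m]. Otherwise [x^m] would be large at
   [c n], and [y] is multiplied by [x^m / (1 + x^m)] instead. *)
have [xn|xn] := leP (c n x) 1.
  have : \forall m \near \oo, forall j : 'I_n, c j x ^+ m < (c j y)^-1.
    apply: filter_forall => j; apply: expr_lt_near.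
      by rewrite absval_ge0 xc.
    by rewrite invr_gt0.
  move=> [m _ /(_ m (leqnn m)) mP].
  exists (x ^+ m * y); split.
    rewrite absvalM absvalX (lt_le_trans y1) // ler_peMl ?absval_ge0 //.
    by rewrite exprn_ege1 // ltW.
  move=> j; rewrite ltnS leq_eqVlt => /orP[/eqP->|jn].
    rewrite absvalM absvalX (le_lt_trans _ yc) // ler_piMl ?absval_ge0 //.
    by rewrite exprn_ile1 // absval_ge0.
  rewrite absvalM absvalX -ltr_pdivlMr // div1r; exact: (mP (Ordinal jn)).
(* The thresholds are exactly what the bounds on the multiplier require: with [t] the value of [x^m]
   at [c j], the first says [t (1 + c j y) < 1], that is [t / (1 - t) * c j y < 1]; the other two
   read likewise in terms of [1 / t]. *)
have : \forall m \near \oo, [/\ forall j : 'I_n, c j x ^+ m < (1 + c j y)^-1,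
    (a x)^-1 ^+ m < a y - 1 & (c n x)^-1 ^+ m < 1 - c n y].
  have h1 : \forall m \near \oo, forall j : 'I_n, c j x ^+ m < (1 + c j y)^-1.
    apply: filter_forall => j; apply: expr_lt_near; first by rewrite absval_ge0 xc.
    by rewrite invr_gt0 addr_gt0.
  have h2 : \forall m \near \oo, (a x)^-1 ^+ m < a y - 1.
    by apply: expr_lt_near; rewrite ?subr_gt0 // invr_ge0 absval_ge0 invf_lt1 // (lt_trans _ x1).
  have h3 : \forall m \near \oo, (c n x)^-1 ^+ m < 1 - c n y.
    by apply: expr_lt_near; rewrite ?subr_gt0 // invr_ge0 absval_ge0 invf_lt1 // (lt_trans _ xn).
  by near=> m; split; near: m.
move=> [m _ /(_ m.+1 (leqnSn m))]; move: m.+1 (ltn0Sn m) => {}m m0 [mc ma mn].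
exists (x ^+ m / (1 + x ^+ m) * y); split.
  have t1 : 1 < a (x ^+ m) by rewrite absvalX exprn_egt1 // -lt0n.
  have [h _] := absval_1D_bounds t1; move: ma.
  rewrite absvalM exprVn -absvalX -[_^-1]mul1r ltr_pdivrMr ?(lt_trans _ t1) // => ma.
  apply: lt_le_trans (_ : a (x ^+ m) / (1 + a (x ^+ m)) * a y <= _).
    rewrite mulrAC ltr_pdivlMr ?mul1r; last by lra.
    by lra.
  by rewrite ler_wpM2r ?absval_ge0.
move=> j; rewrite ltnS leq_eqVlt absvalM => /orP[/eqP->|jn].
  have t1 : 1 < c n (x ^+ m) by rewrite absvalX exprn_egt1 // -lt0n.
  have [_ h] := absval_1D_bounds t1; move: mn.
  rewrite exprVn -absvalX -[_^-1]mul1r ltr_pdivrMr ?(lt_trans _ t1) // => mn.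
  apply: le_lt_trans (_ : c n (x ^+ m) / (c n (x ^+ m) - 1) * c n y < _).
    by rewrite ler_wpM2r ?absval_ge0.
  by rewrite mulrAC ltr_pdivrMr ?mul1r; lra.
have t1 : c j (x ^+ m) < 1 by rewrite absvalX exprn_ilt1 ?absval_ge0 ?xc // -lt0n.
have h := absval_div_1D_le t1; move: (mc (Ordinal jn)) => /=.
rewrite -absvalX -[_^-1]mul1r ltr_pdivlMr => [{}mc|]; last by rewrite addr_gt0.
apply: le_lt_trans (_ : c j (x ^+ m) / (1 - c j (x ^+ m)) * c j y < _).
  by rewrite ler_wpM2r ?absval_ge0.
by rewrite mulrAC ltr_pdivrMr ?mul1r; lra.
Unshelve. all: by end_near.
Qed.

Lemma separated_family_lt a (c : nat -> absval R K) n e : 0 < e ->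
  nontrivial_absval a -> (forall j, (j < n)%N -> separated a (c j)) ->
  exists x, 1 < a x /\ forall j, (j < n)%N -> c j x < e.
Proof.
move=> e0 nt /(separated_family nt)[x [x1 xc]].
have : \forall m \near \oo, forall j : 'I_n, c j x ^+ m < e.
  by apply: filter_forall => j; apply: expr_lt_near; rewrite ?absval_ge0 ?xc.
move=> [m _ /(_ m.+1 (leqnSn m)) mP]; exists (x ^+ m.+1).
split; first by rewrite absvalX exprn_egt1.
by move=> j jn; rewrite absvalX; exact: (mP (Ordinal jn)).
Qed.

(** Fix [z] with [a z > 1]. A rational number strictly between [log a(x) / log a(z)] and
    [log b(x) / log b(z)] would yield a product of powers of [x] and [z] that is small for [a] but
    not for [b]. This gives one inequality between the two ratios, and [x^-1] gives the other; the
    exponent is [log b(z) / log a(z)]. *)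
Lemma equiv_absval_of_lt1 a b : nontrivial_absval a ->
  (forall x, a x < 1 -> b x < 1) -> equiv_absval a b.
Proof.
move=> [z0 [z00 az0]] ab.
have [z [zn0 az]] : exists z, z != 0 /\ 1 < a z.
  have [az1|az1] := ltP 1 (a z0); first by exists z0.
  exists z0^-1; split; rewrite ?invr_eq0 // absvalV invf_gt1 ?absval_gt0 //.
  by rewrite lt_neqAle az0.
have ab' x : 1 < a x -> 1 < b x.
  move=> x1; have x0 : x != 0 by rewrite -(absval_gt0 a) (lt_trans _ x1).
  by have := ab x^-1; rewrite !absvalV !invf_lt1 ?absval_gt0 //; apply.
have bz := ab' z az; have laz := ln_gt0 az; have lbz := ln_gt0 bz.
have LM (c : absval R K) x y : x != 0 -> y != 0 -> ln (c (x * y)) = ln (c x) + ln (c y).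
  by move=> x0 y0; rewrite absvalM lnM // posrE absval_gt0.
have LV (c : absval R K) x : x != 0 -> ln (c x^-1) = - ln (c x).
  by move=> x0; rewrite absvalV lnV // posrE absval_gt0.
have LX (c : absval R K) x n : x != 0 -> ln (c (x ^+ n)) = n%:R * ln (c x).
  by move=> x0; rewrite absvalX lnXn ?absval_gt0 // mulr_natl.
have LZ (c : absval R K) x (n : int) : x != 0 -> ln (c (x ^ n)) = n%:~R * ln (c x).
  move=> x0; case: n => n; first by rewrite -exprnP LX.
  by rewrite NegzE -invr_expz LV ?expfz_neq0 // -exprnP LX // mulrNz mulNr.
have lt1 (c : absval R K) x : x != 0 -> (c x < 1) = (ln (c x) < 0).
  by move=> x0; rewrite -[in RHS](ln1 R) ltr_ln ?posrE ?absval_gt0.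
pose al x := ln (a x) / ln (a z); pose be x := ln (b x) / ln (b z).
have le x : x != 0 -> be x <= al x.
  move=> x0; rewrite leNgt; apply/negP => alb.
  have [q /itvP qP] := rat_in_itvoo alb.
  have d0 : 0 < (denq q)%:~R :> R by rewrite ltr0z denq_gt0.
  have qE : ratr q = (numq q)%:~R / (denq q)%:~R :> R by [].
  pose w := x ^ denq q * z ^ (- numq q).
  have xd0 : x ^ denq q != 0 by rewrite expfz_neq0.
  have zd0 : z ^ (- numq q) != 0 by rewrite expfz_neq0.
  have w0 : w != 0 by rewrite mulf_neq0.
  have lw (c : absval R K) : ln (c w) = (denq q)%:~R * ln (c x) - (numq q)%:~R * ln (c z).
    by rewrite LM // !LZ // mulrNz mulNr.
  have : ln (a w) < 0.
    have : al x < ratr q by rewrite qP.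
    rewrite lw subr_lt0 qE ltr_pdivrMr // mulrAC ltr_pdivlMr // mulrC.
    by rewrite [_ * ln (a z)]mulrC.
  rewrite -lt1 // => /ab; rewrite lt1 // lw subr_lt0 ltNge => /negP; apply.
  have : ratr q <= be x by rewrite ltW // qP.
  by rewrite qE ler_pdivlMr // mulrAC ler_pdivrMr // mulrC [_ * ln (b x)]mulrC.
have albe x : x != 0 -> be x = al x.
  move=> x0; apply/eqP; rewrite eq_le le //=.
  by have := le x^-1; rewrite /be /al !LV // !mulNr lerN2; apply; rewrite invr_eq0.
exists (ln (b z) / ln (a z)); split; first by rewrite divr_gt0.
move=> x; have [->|x0] := eqVneq x 0.
  by rewrite !absval0 powR0 // gt_eqF // divr_gt0.
apply: (@ln_inj R); rewrite ?posrE ?powR_gt0 ?absval_gt0 // ln_powR.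
have := albe x x0; rewrite /be /al => /(congr1 (fun t => t * ln (b z))).
by rewrite divfK ?gt_eqF // => ->; ring.
Qed.
End AbsValTheory.

Section EquivAbsval.
Variables (R : realType) (K : fieldType).
Implicit Types a b c : absval R K.

Lemma equiv_absval_sym a b : equiv_absval a b -> equiv_absval b a.
Proof.
move=> [s [s0 sE]]; exists s^-1; split; first by rewrite invr_gt0.
by move=> x; rewrite sE -powRrM divff ?gt_eqF // powRr1 // absval_ge0.
Qed.

Lemma equiv_absval_trans a b c :
  equiv_absval a b -> equiv_absval b c -> equiv_absval a c.
Proof.
move=> [s [s0 sE]] [t [t0 tE]]; exists (s * t); split; first exact: mulr_gt0.
by move=> x; rewrite tE sE powRrM.
Qed.

Lemma equiv_absval_le1 a b x : equiv_absval a b -> (b x <= 1) = (a x <= 1).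
Proof.
move=> [s [s0 ->]]; have p1 : 1 `^ s = 1 :> R by rewrite powR1.
apply/idP/idP => x1.
  rewrite leNgt; apply/negP => x2; move: x1; rewrite leNgt => /negP; apply.
  by rewrite -[ltLHS]p1 gt0_ltr_powR // ?nnegrE // (le_trans ler01) // ltW.
by rewrite -[leRHS]p1 ge0_ler_powR // ?nnegrE ?absval_ge0 // ltW.
Qed.

Lemma place_eq (v w : place R K) : place_set v = place_set w -> v = w.
Proof.
by case: v w => [A AP] [B BP] /= AB; subst B; congr Place; exact: Prop_irrelevance.
Qed.

(** A place is a whole equivalence class; a representative is fixed here, and only comparisons with
    1, which are invariant under powers, are carried over to other members of the class. *)
Definition place_abs (v : place R K) : absval R K := sval (cid (placeP v)).

Lemma place_abs_nontrivial v : nontrivial_absval (place_abs v).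
Proof. by rewrite /place_abs; case: cid => a []. Qed.

Lemma place_absE v b : place_set v b <-> equiv_absval (place_abs v) b.
Proof. by rewrite /place_abs; case: cid => a [/= _ ->]. Qed.

Lemma place_abs_le1 v b x : place_set v b -> (b x <= 1) = (place_abs v x <= 1).
Proof. by move/place_absE/equiv_absval_le1. Qed.

(** Inequivalence gives [y] small at [v] but not at [w], and [z] small at [w] but not at [v]; the
    quotient [z / y] separates the two places. *)
Lemma place_separated v w : v <> w -> separated (place_abs v) (place_abs w).
Proof.
have key (v' w' : place R K) : v' <> w' ->
    exists y, [/\ y != 0, place_abs v' y < 1 & 1 <= place_abs w' y].
  move=> vw; apply: contrapT => h; apply: vw; apply: place_eq.
  have e : equiv_absval (place_abs v') (place_abs w').
    apply: equiv_absval_of_lt1; first exact: place_abs_nontrivial.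
    move=> x x1; rewrite ltNge; apply/negP => x2; apply: h; exists x; split => //.
    by rewrite -(absval_gt0 (place_abs w')) (lt_le_trans _ x2).
  apply/seteqP; split => b /place_absE => eb; apply/place_absE.
    exact: equiv_absval_trans (equiv_absval_sym e) eb.
  exact: equiv_absval_trans e eb.
move=> vw; have [y [y0 vy wy]] := key v w vw.
have [z [z0 wz vz]] := key w v (nesym vw).
exists (z / y); rewrite !absval_div; split.
  by rewrite ltr_pdivlMr ?absval_gt0 // mul1r (lt_le_trans vy).
by rewrite ltr_pdivrMr ?absval_gt0 // mul1r (lt_le_trans wz).
Qed.
End EquivAbsval.

(** * Places of global fields *)

Lemma infinite_injection (T : Type) (A : set T) : infinite_set A ->
  exists f : nat -> T, injective f /\ forall n, A (f n).
Proof.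
move=> /infiniteP/card_leP[f].
exists (fun n => \val (f (SigSub (mem_setT n)))); split => [m n /val_inj|n].
  by move=> mn; have [] := inj (mem_setT _) (mem_setT _) mn.
exact: set_valP.
Qed.

Section FiniteExtension.
Variables (K F : fieldType) (i : {rmorphism K -> F}).

(** A matrix of coordinates of the [x j] has more rows than columns, hence a nonzero left kernel
    vector. *)
Lemma span_dependent (s : seq F) m (x : 'I_m -> F) : (size s < m)%N ->
  (forall y : F, exists c : 'I_(size s) -> K, y = \sum_k i (c k) * s`_k) ->
  exists c : 'I_m -> K, (exists j, c j != 0) /\ \sum_j i (c j) * x j = 0.
Proof.
move=> sm span; have [C CE] := choice (fun j => span (x j)).
pose A := \matrix_(j < m, k < size s) C j k.
have : kermx A != 0.
  rewrite kermx_eq0 /row_free; apply: contraTneq sm => <-.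
  by rewrite -leqNgt rank_leq_col.
move=> /rowV0Pn[v /sub_kermxP vA v0].
exists (v 0); split.
  apply/existsP; apply: contraNT v0; rewrite negb_exists => /forallP v0.
  by apply/eqP/rowP => j; rewrite mxE; apply/eqP; rewrite -[_ == _]negbK.
transitivity (\sum_(k < size s) i ((v *m A) 0 k) * s`_k); last first.
  by rewrite vA big1 // => k _; rewrite mxE rmorph0 mul0r.
under eq_bigr do rewrite CE mulr_sumr.
rewrite exchange_big; apply: eq_bigr => k _.
rewrite mxE rmorph_sum mulr_suml; apply: eq_bigr => j _.
by rewrite mxE rmorphM mulrA.
Qed.

Lemma finite_extension_algebraic x : finite_extension i ->
  exists2 p : {poly K}, p != 0 & root (map_poly i p) x.
Proof.
move=> [s span].
have [c [[j cj] c0]] := span_dependent (fun j : 'I_(size s).+1 => x ^+ j) (ltnSn _) span.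
exists (\poly_(k < (size s).+1) c (inord k)).
  apply: contraNneq cj => /(congr1 (fun p : {poly K} => p`_j)).
  by rewrite coef0 coef_poly ltn_ord inord_val => ->.
apply/rootP; rewrite -[RHS]c0 (@horner_coef_wide _ (size s).+1); last first.
  by rewrite size_map_poly size_poly.
apply: eq_bigr => k _; by rewrite coef_map coef_poly ltn_ord inord_val.
Qed.

(** The hypothesis on [V] expresses, through unit balls, that its places have a common restriction
    to [K]. Separating elements for more places than the length of a spanning list would satisfy a
    linear relation, whose dominant term is too large at its own place. *)
Lemma finite_places_above (R : realType) (V : set (place R F)) :
  finite_extension i ->
  (forall v w, V v -> V w -> forall c : K,
    place_abs v (i c) <= 1 -> place_abs w (i c) <= 1) ->
  finite_set V.
Proof.
move=> [s span] Vc; apply: contrapT => /infinite_injection[f [fI fV]].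
set N := size s in span; pose a j := place_abs (f j).
(* With this bound the [N] other terms of a relation add up to at most 1, whereas the distinguished
   one exceeds 1. *)
have Ngt : 0 < N.+1%:R^-1 :> R by rewrite invr_gt0.
have /choice[x xP] : forall j : 'I_N.+1, exists x, 1 < a j x /\
    forall k, (k < N)%N -> a (bump j k) x < N.+1%:R^-1.
  move=> j; apply: separated_family_lt => //; first exact: place_abs_nontrivial.
  move=> k _; apply: place_separated => /fI jk.
  by have := neq_bump j k; rewrite -jk eqxx.
have [c [[j0 cj0] c0]] := span_dependent x (ltnSn N) span.
(* The largest coefficient is selected at the place [f 0]. The common restriction then bounds the
   quotients by it at every [f k], in particular at [f j], where they are used. *)
case: (@arg_maxP _ _ _ j0 xpredT (fun j => a 0%N (i (c j))) isT) => j _ jmax.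
have cj : 0 < a 0%N (i (c j)).
  by apply: lt_le_trans (jmax j0 isT); rewrite absval_gt0 fmorph_eq0.
have cj' : c j != 0 by move: cj; rewrite absval_gt0 fmorph_eq0.
have le1 k : a j (i (c k / c j)) <= 1.
  apply: (Vc (f 0%N)) => //.
  by rewrite fmorph_div absval_div ler_pdivrMr // mul1r; exact: jmax.
have : \sum_k i (c k / c j) * x k = 0.
  apply: (mulfI (x := i (c j))); first by rewrite fmorph_eq0.
  rewrite mulr0 -[RHS]c0 mulr_sumr; apply: eq_bigr => k _.
  by rewrite mulrA -rmorphM [c j * _]mulrC divfK.
rewrite (bigD1 j) //= divff // rmorph1 mul1r => /eqP; rewrite addr_eq0 => /eqP xj.
have [xj1 _] := xP j; move: xj1; rewrite ltNge => /negP; apply.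
rewrite xj absvalN; apply: le_trans (absval_sum _ _ _ _) _.
apply: le_trans (_ : \sum_(k < N.+1) N.+1%:R^-1 <= _); last first.
  by rewrite sumr_const card_ord -[leLHS]mulr_natl divff // pnatr_eq0.
rewrite [leRHS](bigD1 j) //=; apply: le_trans (_ : \sum_(k < N.+1 | k != j) N.+1%:R^-1 <= _).
  apply: ler_sum => k kj; rewrite absvalM.
  apply: le_trans (_ : a j (x k) <= _); first by rewrite ler_piMl // absval_ge0.
  (* For [k != j], [unbump k j] is the position of the place [j] in the enumeration that skips
     [k]. *)
  have [_ /(_ (unbump k j))] := xP k.
  rewrite unbumpK ?inE 1?eq_sym // => h; apply/ltW/h.
  rewrite /unbump; have := ltn_ord j; have := ltn_ord k; move: kj; rewrite -val_eqE /=.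
  by case: ltnP; lia.
by rewrite lerDr ltW.
Qed.

End FiniteExtension.

Section AlmostAll.
Variable T : Type.

Definition almost_all (P : set T) := finite_set (~` P).

Lemma almost_allW (P Q : set T) : P `<=` Q -> almost_all P -> almost_all Q.
Proof. by move=> PQ; apply: sub_finite_set => t nQ /PQ. Qed.

Lemma almost_allT (P : set T) : (forall t, P t) -> almost_all P.
Proof.
move=> PT; rewrite /almost_all (_ : ~` P = set0) //.
by apply/seteqP; split => t //=; apply.
Qed.

Lemma almost_allI (P Q : set T) :
  almost_all P -> almost_all Q -> almost_all (P `&` Q).
Proof. by move=> aP aQ; rewrite /almost_all setCI finite_setU. Qed.

Lemma almost_all_seq (I : eqType) (s : seq I) (P : I -> set T) :
  (forall k, k \in s -> almost_all (P k)) ->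
  almost_all [set t | forall k, k \in s -> P k t].
Proof.
elim: s => [_|k s IH sP]; first exact: almost_allT.
have := almost_allI (sP k (mem_head _ _)) (IH (fun l ls => sP l (@mem_behead _ (k :: s) l ls))).
by apply: almost_allW => t [Pk Ps] l; rewrite inE => /predU1P[->|/Ps].
Qed.

Lemma almost_all_fin (I : finType) (P : I -> set T) :
  (forall k, almost_all (P k)) -> almost_all [set t | forall k, P k t].
Proof.
move=> aP; have := @almost_all_seq I (enum I) P (fun k _ => aP k).
by apply: almost_allW => t h k; apply: h; rewrite mem_enum.
Qed.
End AlmostAll.

(** * Archimedean places: comparison on the natural numbers *)

Section Ostrowski.
Variables (R : realType) (F : fieldType).
Implicit Types a b : absval R F.

(** Expansion in base [n]: there are [l] digits, each of absolute value at most [n]. *)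
Lemma absval_nat_lt_expn a n l N : (1 < n)%N -> (N < n ^ l)%N ->
  a N%:R <= l%:R * n%:R * Num.max 1 (a n%:R) ^+ l.
Proof.
move=> n1; set B := Num.max _ _.
have B1 : 1 <= B by rewrite le_max lexx.
have Bn : a n%:R <= B by rewrite le_max lexx orbT.
have B0 : 0 <= B by rewrite (le_trans ler01).
elim: l N => [|l IH] N.
  by rewrite expn0 ltnS leqn0 => /eqP->; rewrite absval0 !mul0r.
move=> Nn; rewrite {1}(divn_eq N n) natrD natrM.
apply: le_trans (absvalD _ _ _) _; rewrite absvalM -natr1 2!mulrDl.
apply: lerD.
  rewrite exprSr mulrA ler_pM ?absval_ge0 // IH //.
  by rewrite ltn_divLR ?(ltnW n1) // -expnSr.
rewrite mul1r; apply: le_trans (absval_nat_le _ _) _.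
apply: le_trans (_ : n%:R <= _); first by rewrite ler_nat ltnW // ltn_mod ltnW.
by rewrite ler_peMr ?ler0n // exprn_ege1.
Qed.

(** The digit bound, applied to the [j]-th powers of both sides for every [j], loses only a factor
    linear in [j]. *)
Lemma absval_nat_expn_le a m k n l : (1 < n)%N -> (m ^ k < n ^ l)%N ->
  a m%:R ^+ k <= Num.max 1 (a n%:R) ^+ l.
Proof.
move=> n1 mn; set B := Num.max _ _.
have B1 : 1 <= B by rewrite le_max lexx.
have Bl : 0 < B ^+ l by rewrite exprn_gt0 // (lt_le_trans ltr01).
rewrite -[leRHS]mul1r -ler_pdivrMr //.
(* The summand 1 covers [j = 0], where the strict inequality between the powers fails. *)
apply: (@le1_of_expr_le R _ (l%:R * n%:R + 1)).
  by rewrite divr_ge0 ?(ltW Bl) ?exprn_ge0 ?absval_ge0.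
move=> j; rewrite expr_div_n ler_pdivrMr; last by rewrite exprn_gt0.
have [->|j0] := posnP j.
  by rewrite !expr0 !mulr1 lerDr mulr_ge0.
rewrite -!exprM -absvalX -natrX.
have := @absval_nat_lt_expn a n (l * j) (m ^ (k * j)) n1.
rewrite !expnM ltn_exp2r // => /(_ mn) /le_trans; apply.
rewrite ler_wpM2r ?exprn_ge0 ?(le_trans ler01) // natrM mulrDl mul1r.
rewrite -natr1 mulrDr mulr1 -addrA [leLHS](_ : _ = l%:R * n%:R * j%:R); last by ring.
by rewrite lerDl !addr_ge0 // mulr_ge0.
Qed.

(** If [a n <= 1] for a single [n > 1], then [m < n ^ m] forces [a m <= 1] for every [m]. *)
Lemma archimedean_gt1 a m n :
  1 < a m%:R -> (1 < n)%N -> 1 < a n%:R.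
Proof.
move=> m1 n1; rewrite ltNge; apply/negP => an.
have := @absval_nat_expn_le a m 1 n m n1; rewrite expn1 ltn_expl // => /(_ isT).
by rewrite (max_idPl an) expr1n expr1 leNgt m1.
Qed.

Lemma expn_lt_double m n : (0 < m < n)%N -> exists k, (2 * m ^ k < n ^ k)%N.
Proof.
(* By Bernoulli, [(1 + 1/m) ^ (2m)] is at least 3. *)
move=> /andP[m0 mn]; exists (2 * m)%N.
apply: (@leq_trans (m.+1 ^ (2 * m))); last by rewrite leq_exp2r // muln_gt0.
rewrite -(ltr_nat rat) natrM !natrX.
have m0' : 0 < m%:R :> rat by rewrite ltr0n.
rewrite -[m.+1%:R]natr1 (_ : m%:R + 1 = m%:R * (1 + m%:R^-1) :> rat); last first.
  by rewrite mulrDr mulr1 divff // gt_eqF.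
rewrite exprMn mulrC ltr_pM2l ?exprn_gt0 //.
apply: lt_le_trans (bernoulli_le _ _); last by rewrite invr_ge0 ltW.
by rewrite natrM mulfK ?gt_eqF.
Qed.

(** Comparing powers gives weak inequalities only. The spare factor 2 in [2 * m ^ k < n ^ k],
    together with [a 2 > 1], makes the result strict. *)
Lemma archimedean_nat_lt a k0 m n :
  1 < a k0%:R -> (m < n)%N -> a m%:R < a n%:R.
Proof.
move=> a1 mn; have agt := fun k => @archimedean_gt1 a k0 k a1.
have [n1|n1] := leqP n 1.
  have -> : m = 0%N by lia.
  have -> : n = 1%N by lia.
  by rewrite absval0 absval1.
have [->|m0] := posnP m; first by rewrite absval0 (lt_trans _ (agt _ n1)).
have am : 0 < a m%:R.
  have [m1|m1] := leqP m 1; last by rewrite (lt_trans _ (agt _ m1)).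
  have -> : m = 1%N by lia.
  by rewrite absval1.
have [|k kP] := @expn_lt_double m n; first by rewrite m0.
rewrite ltNge; apply/negP => nm.
have := @absval_nat_expn_le a (2 * m ^ k) 1 n k n1; rewrite expn1 => /(_ kP).
rewrite (max_idPr (ltW (agt _ n1))) expr1 natrM natrX absvalM absvalX leNgt.
move=> /negP; apply; apply: le_lt_trans (_ : a m%:R ^+ k < _).
  by rewrite lerXn2r // nnegrE absval_ge0.
by rewrite ltr_pMl ?exprn_gt0 // agt.
Qed.

Lemma archimedean_nat_le a k0 m n :
  1 < a k0%:R -> (a m%:R <= a n%:R) = (m <= n)%N.
Proof.
move=> a1; case: (ltngtP m n) => [mn|nm|->]; last by rewrite lexx.
  by rewrite ltW // (archimedean_nat_lt a1).
by rewrite leNgt (archimedean_nat_lt a1).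
Qed.

(** Monotonicity on the natural numbers identifies the unit ball on the rationals with that of the
    usual absolute value, so all archimedean places share it. *)
Lemma archimedean_rat_le1 (i : {rmorphism rat -> F}) a k0 (c : rat) :
  1 < a k0%:R -> (a (i c) <= 1) = (`|numq c| <= `|denq c|)%N.
Proof.
move=> a1; have aE (z : int) : a (i z%:~R) = a (`|z|%N)%:R.
  rewrite rmorph_int; case: z => z //.
  by rewrite NegzE mulrNz absvalN.
rewrite -[c]divq_num_den fmorph_div absval_div ler_pdivrMr; last first.
  by rewrite absval_gt0 fmorph_eq0 intr_eq0 denq_neq0.
by rewrite mul1r !aE (archimedean_nat_le _ _ a1) divq_num_den.
Qed.

Lemma finite_archimedean_places (i : {rmorphism rat -> F}) :
  finite_extension i ->
  finite_set [set v : place R F | exists n, 1 < place_abs v n%:R].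
Proof.
move=> fin; apply: (finite_places_above fin) => v w [m vm] [n wn] c.
by rewrite (archimedean_rat_le1 _ _ vm) (archimedean_rat_le1 _ _ wn).
Qed.
End Ostrowski.

(** * Places bounded on a ring [O] with finite residue rings: the integers and [F_p[X]] treated
    together *)

Section FractionField.
Variables (R : realType) (O : comNzRingType) (K F : fieldType).
Variables (j : {rmorphism O -> K}) (i : {rmorphism K -> F}).
Hypothesis (finF : finite_extension i).
Hypothesis fracK : forall c : K, exists a b u w : O,
  [/\ j b != 0, c = j a / j b & u * a + w * b = 1].
Hypothesis residues : forall d : O, j d != 0 ->
  exists rs : seq O, forall x, exists y r, r \in rs /\ x = d * y + r.

Let bounded_on (v : place R F) := forall x : O, place_abs v (i (j x)) <= 1.

Lemma bounded_nonarchimedean v : bounded_on v -> nonarchimedean (place_abs v).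
Proof.
by move=> vO; apply: nonarchimedean_nat => n; have := vO n%:R; rewrite !rmorph_nat.
Qed.

(* On K such a place is determined by the prime ideal of elements of O of
   absolute value < 1, hence by a subset of the finite ring O/d. *)
Lemma finite_places_dvd (d : O) : j d != 0 ->
  finite_set [set v : place R F | bounded_on v /\ place_abs v (i (j d)) < 1].
Proof.
move=> /residues[rs rsP]; set V := [set v | _].
pose Z (v : place R F) (x : O) := place_abs v (i (j x)) < 1.
(* Places are sorted by which residue representatives they make small; there are finitely many such
   patterns, and one pattern determines the unit ball on [K]. *)
pose C (T : {ffun seq_sub rs -> bool}) :=
  [set v | V v /\ forall r : seq_sub rs, Z v (val r) = T r].
rewrite (_ : V = \bigcup_(T in setT) C T); last first.
  apply/seteqP; split => [v Vv|v [T _ [//]]].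
  by exists [ffun r => Z v (val r)] => //; split => // r; rewrite ffunE.
apply: bigcup_finite; first exact: finite_finset.
move=> T _; apply: (finite_places_above finF) => v w [[vO vd] vT] [[wO wd] wT].
have Zd u x r : bounded_on u -> Z u d -> Z u r -> Z u (d * x + r).
  rewrite /Z => uO ud ur; rewrite !rmorphD !rmorphM.
  apply: le_lt_trans (bounded_nonarchimedean uO _ _) _; rewrite gt_max ur andbT.
  by rewrite absvalM (le_lt_trans _ ud) // ler_piMr ?absval_ge0.
have ZE x : Z v x = Z w x.
  have [y [r [rr ->]]] := rsP x.
  have Zr u : bounded_on u -> Z u d -> Z u (d * y + r) = Z u r.
    move=> uO ud; apply/idP/idP => h; last exact: Zd.
    have -> : r = d * (- y) + (d * y + r) by rewrite mulrN addKr.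
    exact: Zd.
  by rewrite !Zr // (vT (SeqSub rr)) (wT (SeqSub rr)).
move=> c; have [a [b [u [t [b0 -> ub]]]]] := fracK c.
have b0' (x : place R F) : 0 < place_abs x (i (j b)) by rewrite absval_gt0 fmorph_eq0.
rewrite fmorph_div !absval_div !ler_pdivrMr // !mul1r => ab.
(* If [b] were small at [w], it would be small at [v], and so would [a], since its absolute value
   there is at most that of [b]; the Bezout relation would then make 1 small. *)
have nZ : ~~ Z w b.
  rewrite -ZE; apply/negP => bZ.
  suff : Z v 1 by rewrite /Z !rmorph1 absval1 ltxx.
  have Zm x y : Z v y -> Z v (x * y).
    by rewrite /Z => yZ; rewrite !rmorphM absvalM (le_lt_trans _ yZ) // ler_piMl ?absval_ge0.
  have aZ : Z v a by exact: le_lt_trans bZ.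
  rewrite -ub /Z !rmorphD.
  apply: le_lt_trans (bounded_nonarchimedean vO _ _) _; rewrite gt_max.
  by apply/andP; split; apply: Zm.
by apply: le_trans (wO a) _; rewrite leNgt.
Qed.

(** An exceptional place makes the denominator of [c] small. *)
Lemma finite_places_bounded (c : K) :
  finite_set [set v : place R F | bounded_on v /\ ~ place_abs v (i c) <= 1].
Proof.
have [a [b [u [t [b0 -> _]]]]] := fracK c.
apply: sub_finite_set (finite_places_dvd b0) => v [vO vc]; split => //.
rewrite ltNge; apply/negP => b1; apply: vc.
rewrite fmorph_div absval_div ler_pdivrMr ?absval_gt0 ?fmorph_eq0 // mul1r.
exact: le_trans b1.
Qed.
End FractionField.

Lemma nonarchimedean_dominant (R : realType) (K : fieldType) (a : absval R K) x y :
  nonarchimedean a -> a x < a y -> a (x + y) = a y.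
Proof.
move=> na xy; apply/eqP; rewrite eq_le; apply/andP; split.
  by apply: le_trans (na _ _) _; rewrite ge_max lexx ltW.
have := na (- x) (x + y); rewrite addKr absvalN le_max => /orP[|//].
by rewrite leNgt xy.
Qed.

Section NumberField.
Variables (R : realType) (F : fieldType) (i : {rmorphism rat -> F}).
Hypothesis finF : finite_extension i.

Lemma almost_all_rat_bounded (c : rat) :
  almost_all [set v : place R F | place_abs v (i c) <= 1].
Proof.
have bnd (v : place R F) : ~ (exists n, 1 < place_abs v n%:R) ->
    forall x : int, place_abs v (i (x%:~R : rat)) <= 1.
  move=> nv x; rewrite leNgt; apply/negP => x1; apply: nv.
  exists `|x|%N; move: x1; rewrite rmorph_int; case: x => x //.
  by rewrite NegzE mulrNz absvalN.
have fin : finite_set [set v : place R F |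
    (forall x : int, place_abs v (i (intr x : rat)) <= 1) /\ ~ place_abs v (i c) <= 1].
  apply: (@finite_places_bounded R int rat F intr i finF).
  - move=> q; exists (numq q), (denq q).
    have /eqP := coprime_num_den q; rewrite -[gcdn _ _]/(absz (gcdz (numq q) (denq q))).
    have [u [w uw]] := Bezoutz (numq q) (denq q) => g1.
    exists u, w; split; [by rewrite intr_eq0 denq_neq0|by rewrite divq_num_den|].
    by rewrite uw /gcdz -[gcdn _ _]/(absz (gcdz (numq q) (denq q))) g1.
  move=> d; rewrite intr_eq0 => d0.
  exists [seq Posz n | n <- iota 0 `|d|] => x.
  exists (x %/ d)%Z, (x %% d)%Z; split; last by rewrite mulrC -divz_eq.
  apply/mapP; exists `|(x %% d)%Z|%N; last by rewrite gez0_abs // modz_ge0.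
  rewrite mem_iota add0n -ltz_nat gez0_abs ?modz_ge0 //.
  by rewrite abszE; exact: ltz_mod.
have := conj (@finite_archimedean_places R F i finF) fin; rewrite -finite_setU.
apply: sub_finite_set.
move=> v /= vc; have [h|h] := pselect (exists n, 1 < place_abs v n%:R); first by left.
by right; split => //; exact: bnd.
Qed.

Lemma almost_all_nonarchimedean_rat :
  almost_all [set v : place R F | nonarchimedean (place_abs v)].
Proof.
apply: sub_finite_set (@finite_archimedean_places R F i finF) => v /= nv.
apply: contrapT => h; apply: nv; apply: nonarchimedean_nat => n.
by rewrite leNgt; apply/negP => n1; apply: h; exists n.
Qed.
End NumberField.

(** * Finite extensions of [F_p(X)], including the places at infinity *)

Section FunctionField.
Variables (R : realType) (F : fieldType) (p : nat).
Variables (i : {rmorphism {fraction {poly 'F_p}} -> F}).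
Hypotheses (p_prime : prime p) (finF : finite_extension i).

Let g (f : {poly 'F_p}) : F := i (FracField.tofrac f).

(** Since [c ^ p = c], its absolute value equals its own [p]-th power, which is impossible above
    1. *)
Lemma absval_const (a : absval R F) (c : 'F_p) : a (g c%:P) <= 1.
Proof.
rewrite leNgt; apply/negP => c1.
have : a (g c%:P) ^+ p = a (g c%:P).
  rewrite -absvalX /g -!rmorphXn /=; congr (a (i (FracField.tofrac _%:P))).
  by have := expf_card c; rewrite card_Fp.
move/eqP; rewrite gt_eqF // -{1}[a _]expr1 ltr_eXn2l //.
exact: prime_gt1.
Qed.

Lemma nonarchimedean_function_field (a : absval R F) : nonarchimedean a.
Proof.
apply: nonarchimedean_nat => n.
by have := absval_const a n%:R; rewrite /g !rmorph_nat.
Qed.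

(** Nonzero constants have absolute value 1, so the leading term strictly dominates. At infinity
    only the degree counts, and this fixes the unit ball on [F_p(X)]. *)
Lemma absval_poly (a : absval R F) (f : {poly 'F_p}) : f != 0 ->
  1 < a (g 'X) -> a (g f) = a (g 'X) ^+ (size f).-1.
Proof.
move=> f0 X1; have gE : g f = \sum_(k < size f) g (f`_k)%:P * g 'X ^+ k.
  rewrite {1}/g -{1}[f]coefK poly_def !rmorph_sum; apply: eq_bigr => k _.
  by rewrite -mul_polyC !rmorphM !rmorphXn.
have sf : (0 < size f)%N by rewrite size_poly_gt0.
rewrite gE -(prednK sf) big_ord_recr /=.
have lc : a (g (f`_(size f).-1)%:P * g 'X ^+ (size f).-1) = a (g 'X) ^+ (size f).-1.
  rewrite absvalM absvalX; have [a1|a1] := leP 1 (a (g (f`_(size f).-1)%:P)).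
    by rewrite (_ : a _ = 1) ?mul1r //; apply/eqP; rewrite eq_le a1 absval_const.
  (* The inverse of the leading coefficient is also a constant, which excludes an absolute value
     below 1. *)
  have := absval_const a (lead_coef f)^-1.
  have cE : g (lead_coef f)^-1%:P = (g (lead_coef f)%:P)^-1.
    have gM x y : g (x * y) = g x * g y by rewrite /g !rmorphM.
    apply: (@mulIf _ (g (lead_coef f)%:P)).
      by rewrite /g fmorph_eq0 tofrac_eq0 polyC_eq0 lead_coef_eq0.
    rewrite mulVf; last by rewrite /g fmorph_eq0 tofrac_eq0 polyC_eq0 lead_coef_eq0.
    by rewrite -gM -polyCM mulVf ?lead_coef_eq0 // /g !rmorph1.
  rewrite cE absvalV lead_coefE invf_le1; first by rewrite leNgt a1.
  by rewrite absval_gt0 /g fmorph_eq0 tofrac_eq0 polyC_eq0 -lead_coefE lead_coef_eq0.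
have X0 : 0 < a (g 'X) by rewrite (lt_trans _ X1).
rewrite nonarchimedean_dominant //; first exact: nonarchimedean_function_field.
rewrite lc; have [->|n0] := posnP (size f).-1; first by rewrite big_ord0 absval0 expr0.
apply: le_lt_trans (_ : a (g 'X) ^+ (size f).-2 < _).
  apply: nonarchimedean_sum; first exact: nonarchimedean_function_field.
    by rewrite exprn_ge0 // ltW.
  move=> k _; rewrite absvalM absvalX.
  apply: le_trans (_ : a (g 'X) ^+ k <= _).
    by rewrite ler_piMl ?exprn_ge0 ?absval_ge0 ?absval_const.
  by rewrite ler_weXn2l ?(ltW X1) // -ltnS prednK.
by rewrite ltr_eXn2l // prednK.
Qed.

Lemma fraction_reduced (c : {fraction {poly 'F_p}}) :
  exists a b u w : {poly 'F_p}, [/\ FracField.tofrac b != 0,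
    c = FracField.tofrac a / FracField.tofrac b & u * a + w * b = 1].
Proof.
have [a [b [b0 ->]]] : exists a b : {poly 'F_p}, b != 0 /\
    c = FracField.tofrac a / FracField.tofrac b.
  elim/quotW: c => x; exists (frac x).1, (frac x).2.
  have d0 : (frac x).2 != 0 by exact: denom_ratioP.
  split => //; have d0' : FracField.tofrac (frac x).2 != 0 by rewrite tofrac_eq0.
  apply: (mulIf d0'); rewrite divfK // -[LHS]/(FracField.mul _ _) !piE.
  apply/eqmodP; rewrite /= FracField.equivfE /FracField.mulf.
  by rewrite !numden_Ratio ?oner_eq0 ?mulf_neq0 // ?oner_eq0 // !mulr1 mulrC.
have g0 : gcdp a b != 0 by rewrite gcdp_eq0 negb_and b0 orbT.
have [aE bE] := (divpK (dvdp_gcdl a b), divpK (dvdp_gcdr a b)).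
set a' := a %/ gcdp a b in aE; set b' := b %/ gcdp a b in bE.
have cop : coprimep a' b' by rewrite coprimep_div_gcd // b0 orbT.
have [[u w] /= uw] := Bezout_eq1_coprimepP _ _ cop.
have gF : FracField.tofrac (gcdp a b) != 0 by rewrite tofrac_eq0.
have b'0 : b' != 0 by apply: contraNneq b0 => b'0; rewrite -bE b'0 mul0r.
exists a', b', u, w; split; [by rewrite tofrac_eq0| |exact: uw].
rewrite -[X in FracField.tofrac X / _]aE -[X in _ / FracField.tofrac X]bE.
by rewrite (tofracM a') (tofracM b') -mulf_div (divff gF) mulr1.
Qed.

Lemma poly_residues (d : {poly 'F_p}) : d != 0 ->
  exists rs : seq {poly 'F_p}, forall x, exists y r, r \in rs /\ x = d * y + r.
Proof.
(* Remainders are coded by coefficient vectors over the finite field, with one more entry than a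
   remainder modulo [d] can use. *)
move=> d0; exists [seq rVpoly v | v <- enum {: 'rV['F_p]_(size d)}] => x.
exists (x %/ d), (x %% d); split; last by rewrite mulrC -divp_eq.
apply/mapP; exists (poly_rV (x %% d)); first by rewrite mem_enum.
by rewrite poly_rV_K // ltnW // ltn_modp.
Qed.

Lemma almost_all_function_field_bounded (c : {fraction {poly 'F_p}}) :
  almost_all [set v : place R F | place_abs v (i c) <= 1].
Proof.
have fin : finite_set [set v : place R F |
    (forall x, place_abs v (g x) <= 1) /\ ~ place_abs v (i c) <= 1].
  apply: (@finite_places_bounded R {poly 'F_p} _ F (@FracField.tofrac _) i finF).
    exact: fraction_reduced.
  by move=> d; rewrite tofrac_eq0; exact: poly_residues.
(* Places above infinity: there a nonzero fraction is integral exactly when its numerator has degree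
   at most that of its denominator, whichever the place. *)
have finX : finite_set [set v : place R F | 1 < place_abs v (g 'X)].
  apply: (finite_places_above finF) => v w vX wX q.
  have [a [b [_ [_ [b0 -> _]]]]] := fraction_reduced q.
  have {}b0 : b != 0 by rewrite -tofrac_eq0.
  have [->|a0] := eqVneq a 0.
    by rewrite tofrac0 mul0r rmorph0 !absval0.
  have E (u : place R F) : 1 < place_abs u (g 'X) ->
      (place_abs u (i (FracField.tofrac a / FracField.tofrac b)) <= 1) =
      ((size a).-1 <= (size b).-1)%N.
    move=> uX; rewrite fmorph_div absval_div ler_pdivrMr; last first.
      by rewrite absval_gt0 fmorph_eq0 tofrac_eq0.
    rewrite mul1r -[i (FracField.tofrac a)]/(g a) -[i (FracField.tofrac b)]/(g b). 
    by rewrite (absval_poly a0 uX) (absval_poly b0 uX) (ler_eXn2l uX).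
  by rewrite !E.
have := conj finX fin; rewrite -finite_setU; apply: sub_finite_set => v /= vc.
have [h|h] := ltP 1 (place_abs v (g 'X)); [by left|right; split => // x].
rewrite {1}/g -[x]coefK poly_def !rmorph_sum.
apply: nonarchimedean_sum => //; first exact: nonarchimedean_function_field.
move=> k _; rewrite -mul_polyC !rmorphM !rmorphXn absvalM absvalX.
rewrite mulr_ile1 ?absval_ge0 ?exprn_ge0 ?absval_ge0 //.
  exact: absval_const.
by rewrite exprn_ile1 // absval_ge0.
Qed.
End FunctionField.

Section GlobalField.
Variables (R : realType) (F : fieldType).

(** An element of [F] is a root of a monic polynomial over [K], whose finitely many coefficients are
    integral at almost all places. *)
Lemma almost_all_finite_extension (K : fieldType) (i : {rmorphism K -> F}) :
  finite_extension i ->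
  almost_all [set v : place R F | nonarchimedean (place_abs v)] ->
  (forall c, almost_all [set v : place R F | place_abs v (i c) <= 1]) ->
  forall x, almost_all [set v : place R F | place_abs v x <= 1].
Proof.
move=> fin na bnd x; have [q q0 qx] := finite_extension_algebraic x fin.
pose r := (lead_coef q)^-1 *: q.
have rm : r \is monic by rewrite monicE lead_coefZ mulVf // lead_coef_eq0.
have rx : root (map_poly i r) x.
  by rewrite map_polyZ rootZ // fmorph_eq0 invr_eq0 lead_coef_eq0.
have := almost_allI na (@almost_all_seq _ _ (polyseq r)
  (fun c => [set v : place R F | place_abs v (i c) <= 1]) (fun c _ => bnd c)).
apply: almost_allW => v [nav vr]; apply: absval_integral nav _ _ rx.
  by rewrite map_monic.
move=> k; rewrite coef_map; have [kr|kr] := ltnP k (size r).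
  by apply: vr; rewrite mem_nth.
by rewrite nth_default // raddf0 absval0.
Qed.

Lemma global_almost_all (F_global : global_field F) :
  almost_all [set v : place R F | nonarchimedean (place_abs v)] /\
  forall x, almost_all [set v : place R F | place_abs v x <= 1].
Proof.
case: F_global => [[i fin]|[p [pp [i fin]]]].
  have na := @almost_all_nonarchimedean_rat R F i fin.
  split => //; apply: (almost_all_finite_extension fin na).
  exact: (@almost_all_rat_bounded R F i fin).
have na : almost_all [set v : place R F | nonarchimedean (place_abs v)].
  by apply: almost_allT => v; exact: nonarchimedean_function_field i pp _.
split => //; apply: (almost_all_finite_extension fin na).
exact: (@almost_all_function_field_bounded R F p i pp fin).
Qed.
End GlobalField.

(** * Ramification *)

Section Inertia.
Variables (R : realType) (F Fs : fieldType) (iota : {rmorphism F -> Fs}).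
Hypotheses (F_global : global_field F) (iotaP : separable_closure iota).
Variable D : forall v : place R F, local_data iota v.

Let sabs v (y : Fs) := compl_sep_abs (D v) (sep_emb (D v) y).

Lemma sep_abs_base_le1 v (c : F) : (sabs v (iota c) <= 1) = (place_abs v c <= 1).
Proof.
rewrite /sabs sep_embE compl_sep_absE; have [a [va ->]] := compl_place (D v).
exact: place_abs_le1.
Qed.

(** Being nonarchimedean can be read off the natural numbers, which already lie in [F]. *)
Lemma sep_abs_nonarchimedean v :
  nonarchimedean (place_abs v) -> nonarchimedean (compl_sep_abs (D v)).
Proof.
move=> na; apply: nonarchimedean_nat => n.
have := sep_abs_base_le1 v n%:R; rewrite /sabs !rmorph_nat => ->.
elim: n => [|n IH]; first by rewrite absval0.
by rewrite -natr1; apply: le_trans (na _ _) _; rewrite ge_max IH absval1 lexx.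
Qed.

Lemma almost_all_integral (y : Fs) : almost_all [set v | sabs v y <= 1].
Proof.
have [p [ps py]] := iotaP.1 y; have p0 := separable_poly_neq0 ps.
have [na bnd] := @global_almost_all R F F_global.
pose r := (lead_coef p)^-1 *: p.
have rm : r \is monic by rewrite monicE lead_coefZ mulVf // lead_coef_eq0.
have ry : root (map_poly iota r) y.
  by rewrite map_polyZ rootZ // fmorph_eq0 invr_eq0 lead_coef_eq0.
have := almost_allI na (@almost_all_seq _ _ (polyseq r)
  (fun c => [set v : place R F | place_abs v c <= 1]) (fun c _ => bnd c)).
apply: almost_allW => v [nav vr].
apply: (@absval_integral R _ _ (map_poly (sep_emb (D v)) (map_poly iota r))).
- exact: sep_abs_nonarchimedean.
- by rewrite !map_monic.
- move=> k; rewrite !coef_map; apply: (_ : sabs v (iota r`_k) <= 1).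
  rewrite sep_abs_base_le1; have [kr|kr] := ltnP k (size r).
    by apply: vr; rewrite mem_nth.
  by rewrite nth_default // absval0.
- by rewrite fmorph_root.
Qed.

(* At almost all places the differences of distinct conjugates of x are units,
   whereas an element of inertia moves x by less than 1. *)
Lemma almost_all_inertia_fix (x : Fs) :
  almost_all [set v | forall s : inertia (D v),
    decomp iotaP (D v) (inertia_incl (D v) s) x = x].
Proof.
have [p [ps px]] := iotaP.1 x.
have [|rs pE] := @separable_split Fs (map_poly iota p) iotaP.2.
  by rewrite separable_map.
have p0 : lead_coef (map_poly iota p) != 0.
  by rewrite lead_coef_eq0 map_poly_eq0; exact: separable_poly_neq0.
have [na _] := @global_almost_all R F F_global.
(* The list [rs] contains [x] itself; its condition holds trivially because [0^-1 = 0]. *)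
have := almost_allI na (almost_allI (almost_all_integral x) (@almost_all_seq _ _ rs
  (fun y => [set v | sabs v (y - x)^-1 <= 1]) (fun y _ => almost_all_integral _))).
apply: almost_allW => v [nav [vx vrs]] s; set y := decomp _ _ _ _.
have yrs : y \in rs.
  have : root (map_poly iota p) y.
    have <- : map_poly (res_gal iotaP (inertia_gal s)) (map_poly iota p) = map_poly iota p.
      rewrite -map_poly_comp; apply: eq_map_poly => a.
      exact: (gal_fix (res_gal iotaP (inertia_gal s))).
    by rewrite fmorph_root.
  by rewrite pE rootZ // root_prod_XsubC.
apply/eqP; rewrite -subr_eq0; apply: contraT => yx.
have /asboolP/(_ (sep_abs_nonarchimedean nav))[_ /(_ (sep_emb (D v) x) vx)] := inertiaP s.
rewrite -res_funE -rmorphB => lt1.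
have := absval1 (compl_sep_abs (D v)).
rewrite -(rmorph1 (sep_emb (D v))) -(divff yx) rmorphM absvalM => E.
have := vrs y yrs; rewrite /= /sabs => le1.
suff : (1 : R) < 1 by rewrite ltxx.
rewrite -[ltLHS]E; apply: le_lt_trans lt1.
by rewrite -[leRHS]mulr1 ler_wpM2l // absval_ge0.
Qed.

Definition unramified_at v (M : gmod (gal iota)) := forall (s : inertia (D v)) (m : M),
  gact (decomp iotaP (D v) (inertia_incl (D v) s)) m = m.

(** The stabilizer of each [m] contains every automorphism fixing a certain finite list of elements
    of [Fs], and inertia fixes that list at almost all places. *)
Lemma almost_all_unramified (M : gmod (gal iota)) :
  almost_all [set v | unramified_at v M].
Proof.
have aM (m : M) : almost_all [set v | forall s : inertia (D v),
    gact (decomp iotaP (D v) (inertia_incl (D v) s)) m = m].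
  have /gal_openE := gact_discrete m.
  move=> /(_ 1%g (gact1 m))[e eP].
  have := @almost_all_seq _ _ e _ (fun x _ => almost_all_inertia_fix x).
  by apply: almost_allW => v ve s; apply: eP => x xe; rewrite (ve x xe s).
by have := almost_all_fin aM; apply: almost_allW => v vM s m; exact: vM.
Qed.
End Inertia.

(** * Compact open subgroups of the restricted product *)

Section RestrictedProductTopology.
Variables (R : realType) (F Fs : fieldType) (iota : {rmorphism F -> Fs}).
Variables (iotaP : separable_closure iota).
Variable D : forall v : place R F, local_data iota v.
Variable M : gmod (gal iota).

Local Notation rp := (rprod iotaP D M).

HB.instance Definition _ := isPointed.Build rp 0.

Lemma rprodDE (x y : rp) v : (x + y) v = x v + y v. Proof. by []. Qed.
Lemma rprodNE (x : rp) v : (- x) v = - x v. Proof. by []. Qed.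
Lemma rprodBE (x y : rp) v : (x - y) v = x v - y v. Proof. by []. Qed.
Lemma rprod0E v : (0 : rp) v = 0. Proof. by []. Qed.

Lemma rprod_openP (O : set rp) : open O <-> rprod_open O.
Proof. by []. Qed.

(** For finite [S] these subgroups form a basis of open neighbourhoods of 0, so that openness of a
    subgroup means containing one of them. *)
Definition unit_box (S : set (place R F)) : set rp :=
  [set x | forall v, (S v -> x v = 0) /\ (~ S v -> H1ur (x v))].

(** A stand-in for compactness that can be checked place by place, hence passes to the Selmer groups
    built below. *)
Definition box_bounded (W : set rp) :=
  exists (S : set (place R F)) (K : forall v, set (H1v iotaP (D v) M)),
    [/\ finite_set S, forall v, finite_set (K v) &
        forall x, W x -> forall v, K v (x v) /\ (~ S v -> H1ur (x v))].

Lemma unit_boxN S x : unit_box S x -> unit_box S (- x).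
Proof.
move=> Sx v; have [x0 xu] := Sx v; rewrite rprodNE; split => Sv.
  by rewrite x0 // oppr0.
exact/H1urN/xu.
Qed.

Lemma unit_boxS S T : S `<=` T -> unit_box T `<=` unit_box S.
Proof.
move=> ST x xT v; have [x0 xu] := xT v; split => [/ST/x0//|_].
have [/x0->|/xu//] := pselect (T v); exact: H1ur0.
Qed.

Lemma open_of_unit_box S (O : set rp) : finite_set S ->
  (forall x y, O x -> unit_box S y -> O (x + y)) -> open O.
Proof.
move=> fS SO; apply/rprod_openP => x Ox.
(* The translate by [x] of the unit box. Off [S] and off the finitely many places where [x]
   ramifies, its factor is a coset of an unramified class, hence [H1ur] itself. *)
exists (fun v => [set z | (S v -> z = x v) /\ (~ S v -> H1ur (z - x v))]).
split.
- have := conj fS (rprod_finite x); rewrite -finite_setU; apply: sub_finite_set.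
  move=> v /= Uv; apply: contrapT => /not_orP[nS /contrapT xu]; apply: Uv.
  apply/seteqP; split => z /=.
    by move=> [_ /(_ nS) zx]; rewrite -(subrK (x v) z); exact: H1urD.
  by move=> zu; split => // _; apply: H1urD => //; exact: H1urN.
- by move=> v; split => // _; rewrite subrr; exact: H1ur0.
- move=> y yU; rewrite -(subrK x y) addrC; apply: SO => // v.
  have [y0 yu] := yU v; rewrite rprodBE; split => [Sv|]; last exact: yu.
  by rewrite y0 // subrr.
Qed.

Lemma unit_box_of_open (W : set rp) : open W -> W 0 ->
  exists2 S, finite_set S & unit_box S `<=` W.
Proof.
move=> /rprod_openP oW W0; have [U [bU U0 UW]] := oW 0 W0.
exists [set v | U v <> H1ur (M := M)] => // x xS; apply: UW => v.
have [x0 xu] := xS v.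
have [Uv|Uv] := pselect (U v = H1ur (M := M)); first by rewrite Uv; apply: xu.
by rewrite x0 //; exact: U0.
Qed.

(** [W] is covered by finitely many translates of each unit box. Taking [S] empty bounds the places
    of ramification uniformly, and taking [S = {v}] leaves finitely many values at [v]. *)
Lemma compact_box_bounded (W : set rp) : compact W -> box_bounded W.
Proof.
rewrite compact_cover => cW.
have cov (S : set (place R F)) : finite_set S -> exists2 B : set rp, finite_set B &
    forall x, W x -> exists2 y, B y & unit_box S (x - y).
  move=> fS; pose f (y : rp) := [set x : rp | unit_box S (x - y)].
  have [||E _ EW] := cW _ W f.
  - move=> y _; apply: (open_of_unit_box fS) => x z xy zS v.
    have [xy0 xyu] := xy v; have [z0 zu] := zS v.
    rewrite addrAC rprodDE; split => Sv; first by rewrite xy0 // z0 // addr0.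
    by apply: H1urD; [exact: xyu|exact: zu].
  - move=> x Wx; exists x => //= v; rewrite subrr rprod0E; split => // _.
    exact: H1ur0.
  exists [set` E]; first exact: finite_fset.
  by move=> x /EW[y yE xy]; exists y.
have [B fB BW] := cov set0 (@finite_set0 _).
have /choice[C CP] : forall v, exists C : set rp, finite_set C /\
    forall x, W x -> exists2 y, C y & x v = y v.
  move=> v; have [C fC CW] := cov [set v] (finite_set1 v).
  exists C; split => // x /CW[y Cy xy]; exists y => //.
  by have [/(_ erefl) /eqP] := xy v; rewrite rprodBE subr_eq0 => /eqP.
exists (\bigcup_(y in B) [set v | ~ H1ur (y v)]), (fun v => [set y v | y in C v]).
split.
- by apply: bigcup_finite => // y _; exact: rprod_finite.
- by move=> v; apply: finite_image; have [] := CP v.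
- move=> x Wx v; split.
    by have [_ /(_ x Wx)[y Cy xy]] := CP v; exists y.
  move=> nS; have [y By xy] := BW x Wx.
  rewrite -(subrK (y v) (x v)); apply: H1urD.
    by have [_ ] := xy v; rewrite rprodBE; apply.
  by apply: contrapT => yv; apply: nS; exists y.
Qed.

(** As in Tychonoff's theorem: an ultrafilter selects one value in each finite factor. The selected
    values are unramified off [S], so they form a point of the restricted product, and a basic
    neighbourhood of it constrains the box at finitely many places only. *)
Lemma compact_finite_box S (K : forall v, set (H1v iotaP (D v) M)) :
  finite_set S -> (forall v, finite_set (K v)) ->
  (forall v, ~ S v -> K v `<=` H1ur (M := M)) -> compact (box K : set rp).
Proof.
move=> fS fK KS; rewrite compact_ultra => G UG GK.
have kE v : exists k, K v k /\ G [set y : rp | y v = k].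
  apply: contrapT => nk.
  have GI : G (\bigcap_(k in K v) [set y : rp | y v <> k]).
    have /finite_fsetP[X XE] := fK v; rewrite XE; apply: filter_bigI => k kX.
    have [h|//] := in_ultra_setVsetC [set y : rp | y v = k] UG.
    by exfalso; apply: nk; exists k; split => //; rewrite XE.
  have [y [yK yI]] := filter_ex (filterI GK GI).
  exact: (yI (y v)).
pose k v := sval (cid (kE v)).
have kP v : K v (k v) /\ G [set y : rp | y v = k v] := svalP (cid (kE v)).
have kR : k \in @rprod_pred R F Fs iota iotaP D M.
  apply/asboolP; apply: sub_finite_set fS => v kv; apply: contrapT => Sv.
  by apply: kv; apply: (KS v Sv); exact: (kP v).1.
exists (MkRprod kR); split; first by move=> v; exact: (kP v).1.
move=> O; rewrite nbhsE => -[O' [/rprod_openP oO' O'k] OO'].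
have [U [bU Uk UO]] := oO' _ O'k; apply: filterS (subset_trans UO OO') _.
(* [{classic _}] supplies the choice structure that listing a finite set of places requires. *)
pose T : set {classic place R F} := S `|` [set v | U v <> H1ur (M := M)].
have /finite_fsetP[X XE] : finite_set T by rewrite finite_setU.
have GI : G (\bigcap_(v in [set` X]) [set y : rp | y v = k v]).
  by apply: filter_bigI => v _; exact: (kP v).2.
apply: filterS (filterI GK GI) => y [yK yI] v.
have [Tv|/not_orP[Sv /contrapT ->]] := pselect (T v); last exact: KS (yK v).
have -> : y v = k v by apply: yI; rewrite -XE.
exact: Uk.
Qed.

(** An open subgroup is closed, its complement being a union of cosets, and here it lies in a
    compact box. *)
Lemma open_subgroup_compact (W : set rp) : W 0 ->
  (forall x y, W x -> W y -> W (x - y)) -> open W -> box_bounded W -> compact W.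
Proof.
move=> W0 WB oW [S [K [fS fK WK]]].
have [T fT TW] := unit_box_of_open oW W0.
have WD x y : W x -> W y -> W (x + y).
  by move=> Wx Wy; rewrite -[y]opprK; apply: (WB) => //; rewrite -sub0r; exact: WB.
apply: (@subclosed_compact _ _ (box (fun v => K v `&` [set z | ~ S v -> H1ur z]))).
- rewrite -openC; apply: (open_of_unit_box fT) => x y nWx Ty Wxy; apply: nWx.
  by rewrite -(addrK y x); apply: WB Wxy _; exact: TW.
- apply: (compact_finite_box fS) => [v|v Sv z [_]]; last exact.
  exact: sub_finite_set (fK v).
- by move=> x Wx v; have [] := WK x Wx v.
Qed.
End RestrictedProductTopology.

(** * Fibre products and pushouts of finite modules *)

Section Fibre.
Variables (G : topGroupType) (A B C : gmod G) (p : ghom A C) (f : ghom B C).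

Definition fibre_pred : {pred (A * B)%type} := fun x => p x.1 == f x.2.

Record fibre := MkFibre { fibre_val :> A * B; fibreP : fibre_val \in fibre_pred }.

Lemma fibre_zmod_closed : zmod_closed fibre_pred.
Proof.
split; first by rewrite /in_mem /= /fibre_pred /= !gh0.
move=> x y /eqP xE /eqP yE; apply/eqP => /=.
by rewrite !ghB xE yE.
Qed.

HB.instance Definition _ :=
  GRing.isZmodClosed.Build (A * B)%type fibre_pred fibre_zmod_closed.
HB.instance Definition _ := [isSub for fibre_val].
HB.instance Definition _ := [Finite of fibre by <:].
HB.instance Definition _ :=
  GRing.SubChoice_isSubZmodule.Build (A * B)%type fibre_pred fibre fibre_zmod_closed.

Lemma fibre_act_subproof (s : G) (x : fibre) :
  (gact s (val x).1, gact s (val x).2) \in fibre_pred.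
Proof.
rewrite /in_mem /= /fibre_pred /= !gh_act; apply/eqP; congr gact.
exact/eqP/(valP x).
Qed.

Definition fibre_act s x : fibre := MkFibre (fibre_act_subproof s x).

Lemma fibre_ext (x y : fibre) : (val x).1 = (val y).1 -> (val x).2 = (val y).2 -> x = y.
Proof. by move=> h1 h2; apply: val_inj; case: (val x) (val y) h1 h2 => ? ? [? ?] /= -> ->. Qed.

Lemma fibre_act1 x : fibre_act 1%g x = x.
Proof. by apply: fibre_ext; rewrite /= gact1. Qed.

Lemma fibre_actM s t x : fibre_act (s * t)%g x = fibre_act s (fibre_act t x).
Proof. by apply: fibre_ext; rewrite /= gactM. Qed.

Lemma fibre_actD s x y : fibre_act s (x + y) = fibre_act s x + fibre_act s y.
Proof. by apply: fibre_ext; rewrite /= gactD. Qed.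

Lemma fibre_discrete x : open [set s | fibre_act s x = x].
Proof.
rewrite (_ : [set _ | _] =
  [set s | gact s (val x).1 = (val x).1] `&` [set s | gact s (val x).2 = (val x).2]).
  by apply: openI; exact: gact_discrete.
apply/seteqP; split => s /=; last by move=> [h1 h2]; exact: fibre_ext.
by move=> E; split; [have := congr1 (fun y => (val y).1) E|have := congr1 (fun y => (val y).2) E].
Qed.

Definition fibre_gmod : gmod G :=
  @GMod G fibre fibre_act fibre_act1 fibre_actM fibre_actD fibre_discrete.
End Fibre.

(** Orbit maps are locally constant: the set is a union of left cosets of the open stabilizer of
    [m]. *)
Lemma open_gact_preimage (G : topGroupType) (M : gmod G) (m : M) (A : set M) :
  open [set s : G | A (gact s m)].
Proof.
rewrite (_ : [set _ | _] = \bigcup_(t in [set t : G | A (gact t m)])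
    ((fun s => t^-1 * s)%g @^-1` [set s | gact s m = m])).
  apply: bigcup_open => t _; apply: open_comp; last exact: gact_discrete.
  move=> s _; apply: (@continuous_comp _ _ _ (fun s : G => (t^-1, s)%g)
    (fun xy : G * G => (xy.1 * xy.2)%g)); last exact: mulg_continuous.
  by apply: cvg_pair; [exact: cvg_cst|exact: cvg_id].
apply/seteqP; split => s /=; first by move=> As; exists s; rewrite //= mulVg gact1.
move=> [t /= At ts]; rewrite -(mulVKg t s) gactM ts; exact: At.
Qed.

HB.instance Definition _ (A B : finZmodType) := GRing.Zmodule.on (A * B)%type.

Section GProduct.
Variables (G : topGroupType) (A B : gmod G).

Definition gprod_act (s : G) (x : A * B) : A * B := (gact s x.1, gact s x.2).

Lemma gprod_act1 x : gprod_act 1%g x = x.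
Proof. by case: x => a b; rewrite /gprod_act !gact1. Qed.

Lemma gprod_actM s t x : gprod_act (s * t)%g x = gprod_act s (gprod_act t x).
Proof. by rewrite /gprod_act !gactM. Qed.

Lemma gprod_actD s x y : gprod_act s (x + y) = gprod_act s x + gprod_act s y.
Proof. by rewrite /gprod_act !gactD. Qed.

Lemma gprod_discrete x : open [set s | gprod_act s x = x].
Proof.
rewrite (_ : [set _ | _] = [set s | gact s x.1 = x.1] `&` [set s | gact s x.2 = x.2]).
  by apply: openI; exact: gact_discrete.
rewrite /gprod_act; case: x => a b.
by apply/seteqP; split => s /= [-> ->].
Qed.

Definition gprod : gmod G :=
  @GMod G (A * B)%type gprod_act gprod_act1 gprod_actM gprod_actD gprod_discrete.
End GProduct.

Section GQuotient.
Variables (G : topGroupType) (A : gmod G) (K : zmodClosed A).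
Hypothesis K_stable : forall (s : G) (x : A), x \in K -> gact s x \in K.

Definition gquot := Quotient.quot K.
HB.instance Definition _ := GRing.Zmodule.on gquot.
HB.instance Definition _ := EqQuotient.on gquot.
HB.instance Definition _ := Countable.copy gquot (can_type (@reprK _ gquot)).
HB.instance Definition _ :=
  isFinite.Build gquot (pcan_enumP (can_pcan (@reprK _ gquot))).

Definition gproj (x : A) : gquot := \pi_(gquot) x.

Lemma gproj_eq x y : gproj x = gproj y <-> x - y \in K.
Proof.
rewrite /gproj; split => [/eqmodP|xy]; first by rewrite /= Quotient.equivE.
by apply/eqmodP; rewrite /= Quotient.equivE.
Qed.

Lemma gprojD x y : gproj (x + y) = gproj x + gproj y.
Proof. by rewrite /gproj [LHS]Quotient.pi_add. Qed.

Lemma gproj_repr (y : gquot) : gproj (repr y) = y.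
Proof. exact: reprK. Qed.

Definition gquot_act s (y : gquot) : gquot := gproj (gact s (repr y)).

Lemma gquot_actE s x : gquot_act s (gproj x) = gproj (gact s x).
Proof.
by apply/gproj_eq; rewrite -gactB K_stable //; apply/gproj_eq; rewrite gproj_repr.
Qed.

Lemma gquot_act1 y : gquot_act 1%g y = y.
Proof. by rewrite /gquot_act gact1 gproj_repr. Qed.

Lemma gquot_actM s t y : gquot_act (s * t)%g y = gquot_act s (gquot_act t y).
Proof. by rewrite -(gproj_repr y) !gquot_actE gactM. Qed.

Lemma gquot_actD s x y : gquot_act s (x + y) = gquot_act s x + gquot_act s y.
Proof.
by rewrite -(gproj_repr x) -(gproj_repr y) -gprojD !gquot_actE gactD gprojD.
Qed.

Lemma gquot_discrete y : open [set s | gquot_act s y = y].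
Proof.
rewrite -(gproj_repr y); move: (repr y) => x.
rewrite (_ : [set _ | _] = [set s | [set z | gproj z = gproj x] (gact s x)]).
  exact: open_gact_preimage.
by apply/seteqP; split => s /=; rewrite gquot_actE.
Qed.

Definition gquot_gmod : gmod G :=
  @GMod G gquot gquot_act gquot_act1 gquot_actM gquot_actD gquot_discrete.
End GQuotient.

Section PushoutModule.
Variables (G : topGroupType) (A B C : gmod G) (i : ghom A B) (g : ghom A C).

(** The antidiagonal image of [A], so that the quotient identifies [i a] with [g a]. *)
Definition pushout_pred : {pred gprod B C} :=
  fun x => [exists a, (i a == x.1) && (- g a == x.2)].

Lemma pushout_zmod_closed : zmod_closed pushout_pred.
Proof.
split; first by apply/existsP; exists 0; rewrite !gh0 oppr0 !eqxx.
move=> x y /existsP[a /andP[/eqP a1 /eqP a2]] /existsP[b /andP[/eqP b1 /eqP b2]].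
apply/existsP; exists (a - b); rewrite !ghB; apply/andP; split; apply/eqP.
  by rewrite a1 b1.
by rewrite opprD -[RHS]/(x.2 - y.2) -a2 -b2.
Qed.

HB.instance Definition _ :=
  GRing.isZmodClosed.Build (gprod B C) pushout_pred pushout_zmod_closed.

Lemma pushout_stable s (x : gprod B C) :
  x \in pushout_pred -> gact s x \in pushout_pred.
Proof.
move=> /existsP[a /andP[/eqP a1 /eqP a2]]; apply/existsP; exists (gact s a).
rewrite !gh_act a1 eqxx /= -[- gact s (g a)]sub0r -(gact0 C s) -gactB sub0r a2.
exact: eqxx.
Qed.

Definition pushout_gmod : gmod G := gquot_gmod pushout_stable.

Definition pushout_pair (b : B) (c : C) : pushout_gmod :=
  @gproj G (gprod B C) pushout_pred (b, c).

Lemma pushout_pairD b b' c c' :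
  pushout_pair (b + b') (c + c') = pushout_pair b c + pushout_pair b' c'.
Proof. by rewrite /pushout_pair -gprojD. Qed.

Lemma pushout_pair_act s b c :
  gact s (pushout_pair b c) = pushout_pair (gact s b) (gact s c).
Proof. by rewrite /pushout_pair -[LHS]/(gquot_act s _) gquot_actE //; exact: pushout_stable. Qed.

Lemma pushout_pair_surj y : exists b c, y = pushout_pair b c.
Proof.
exists (repr y : gprod B C).1, (repr y : gprod B C).2.
by rewrite /pushout_pair -surjective_pairing; rewrite gproj_repr.
Qed.

Lemma pushout_pair_eq b b' c c' : pushout_pair b c = pushout_pair b' c' <->
  exists a, i a = b - b' /\ g a = c' - c.
Proof.
split=> [/gproj_eq/existsP[a /andP[/eqP /= a1 /eqP /= a2]]|[a [a1 a2]]].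
  by exists a; split; rewrite ?a1 // -[g a]opprK a2 opprB.
apply/gproj_eq/existsP; exists a; rewrite a1 a2 opprB /=.
by apply/andP; split.
Qed.

Lemma pushout_inl_act s b : pushout_pair (gact s b) 0 = gact s (pushout_pair b 0).
Proof. by rewrite pushout_pair_act gact0. Qed.
Lemma pushout_inr_act s c : pushout_pair 0 (gact s c) = gact s (pushout_pair 0 c).
Proof. by rewrite pushout_pair_act gact0. Qed.
Lemma pushout_inlD b b' : pushout_pair (b + b') 0 = pushout_pair b 0 + pushout_pair b' 0.
Proof. by rewrite -pushout_pairD addr0. Qed.
Lemma pushout_inrD c c' : pushout_pair 0 (c + c') = pushout_pair 0 c + pushout_pair 0 c'.
Proof. by rewrite -pushout_pairD addr0. Qed.

Definition pushout_inl : ghom B pushout_gmod := GHom pushout_inlD pushout_inl_act.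
Definition pushout_inr : ghom C pushout_gmod := GHom pushout_inrD pushout_inr_act.

Section Desc.
Variables (T : gmod G) (h : ghom B T) (k : ghom C T).
Hypothesis hk : forall a, h (i a) = k (g a).

(** Evaluated on a chosen representative; independence of the choice is [pushout_descE]. *)
Definition pushout_desc_fun (y : pushout_gmod) : T :=
  h (repr y : gprod B C).1 + k (repr y : gprod B C).2.

Lemma pushout_descE b c : pushout_desc_fun (pushout_pair b c) = h b + k c.
Proof.
rewrite /pushout_desc_fun; set y := repr _.
have : pushout_pair (y : gprod B C).1 (y : gprod B C).2 = pushout_pair b c.
  by rewrite {1}/pushout_pair -surjective_pairing; rewrite gproj_repr.
move=> /pushout_pair_eq[a [a1 a2]].
have := hk a; rewrite a1 a2 !ghB => /eqP.
by rewrite subr_eq addrAC eq_sym subr_eq => /eqP <-; rewrite addrC.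
Qed.

Lemma pushout_descD x y :
  pushout_desc_fun (x + y) = pushout_desc_fun x + pushout_desc_fun y.
Proof.
have [b [c ->]] := pushout_pair_surj x; have [b' [c' ->]] := pushout_pair_surj y.
by rewrite -pushout_pairD !pushout_descE !ghD addrACA.
Qed.

Lemma pushout_desc_act s y : pushout_desc_fun (gact s y) = gact s (pushout_desc_fun y).
Proof.
have [b [c ->]] := pushout_pair_surj y.
by rewrite pushout_pair_act !pushout_descE !gh_act gactD.
Qed.

Definition pushout_desc : ghom pushout_gmod T := GHom pushout_descD pushout_desc_act.
End Desc.
End PushoutModule.

Section FibreMaps.
Variables (G : topGroupType) (A B C : gmod G) (p : ghom A C) (f : ghom B C).

Definition fibre_fst : ghom (fibre_gmod p f) A :=
  @GHom G (fibre_gmod p f) A (fun x => (fibre_val x).1) (fun _ _ => erefl) (fun _ _ => erefl).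
Definition fibre_snd : ghom (fibre_gmod p f) B :=
  @GHom G (fibre_gmod p f) B (fun x => (fibre_val x).2) (fun _ _ => erefl) (fun _ _ => erefl).

Lemma fibre_comm x : p (fibre_fst x) = f (fibre_snd x).
Proof. exact/eqP/(fibreP x). Qed.

Section Lift.
Variables (T : gmod G) (h : ghom T A) (k : ghom T B).
Hypothesis hk : forall t, p (h t) = f (k t).

Lemma fibre_lift_subproof t : (h t, k t) \in fibre_pred p f.
Proof. exact/eqP/hk. Qed.

Definition fibre_lift_fun t : fibre_gmod p f := MkFibre (fibre_lift_subproof t).

Lemma fibre_liftD x y : fibre_lift_fun (x + y) = fibre_lift_fun x + fibre_lift_fun y.
Proof. by apply: fibre_ext; rewrite /= ghD. Qed.

Lemma fibre_lift_act s x : fibre_lift_fun (gact s x) = gact s (fibre_lift_fun x).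
Proof. by apply: fibre_ext; rewrite /= gh_act. Qed.

Definition fibre_lift : ghom T (fibre_gmod p f) := GHom fibre_liftD fibre_lift_act.
End Lift.
End FibreMaps.

(** * First cohomology *)

Section Cohomology.
Variable G : topGroupType.
Implicit Types A B C M N : gmod G.

Lemma class10 M : class1 (0 : Z1 M) = 0.
Proof. by apply: (@addrI _ (class1 0)); rewrite -class1D !addr0. Qed.

Lemma class1_eq0 M (c : Z1 M) : class1 c = 0 <-> is_coboundary c.
Proof.
rewrite -class10; split => [/class1_eq|h]; first by rewrite subr0.
by apply/class1_eq; rewrite subr0.
Qed.

Lemma H1mapD M N (f : ghom M N) x y : H1map f (x + y) = H1map f x + H1map f y.
Proof.
rewrite -(class1_repr x) -(class1_repr y) -class1D !H1mapE -class1D.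
congr class1; apply: val_inj; apply/funext => s.
rewrite -[LHS]/(f ((repr x + repr y : Z1 M) s)).
by rewrite -[RHS]/((Z1map f (repr x) + Z1map f (repr y)) s) !z1D ghD.
Qed.

Lemma H1mapN M N (f : ghom M N) x : H1map f (- x) = - H1map f x.
Proof. by apply: (@addrI _ (H1map f x)); rewrite -H1mapD !subrr H1map0. Qed.

Lemma H1mapB M N (f : ghom M N) x y : H1map f (x - y) = H1map f x - H1map f y.
Proof. by rewrite H1mapD H1mapN. Qed.

Lemma H1map_comp A B C (f : ghom A B) (g : ghom B C) (h : ghom A C) x :
  (forall a, h a = g (f a)) -> H1map h x = H1map g (H1map f x).
Proof.
move=> hE; rewrite -(class1_repr x) !H1mapE; congr class1.
by apply: val_inj; apply/funext => s; exact: hE.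
Qed.

Lemma H1map_eq0 M N (f : ghom M N) x : (forall m, f m = 0) -> H1map f x = 0.
Proof.
move=> f0; rewrite -(class1_repr x) H1mapE; apply/class1_eq0.
by exists 0 => s; rewrite gact0 subrr; exact: f0.
Qed.

Lemma H1map_id M (f : ghom M M) x : (forall m, f m = m) -> H1map f x = x.
Proof.
move=> f1; rewrite -[RHS](class1_repr x) -{1}(class1_repr x) H1mapE; congr class1.
by apply: val_inj; apply/funext => s; exact: f1.
Qed.

Lemma coboundary_subproof M (m : M) :
  (fun s => gact s m - m) \in @cocycle_pred G M.
Proof.
apply/asboolP; split => [s t|A]; first by rewrite gactM gactB [RHS]addrC addrA subrK.
exact: (@open_gact_preimage G M m [set x | A (x - m)]).
Qed.

Definition coboundary M (m : M) : Z1 M := MkZ1 (coboundary_subproof m).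

Lemma class1_coboundary M (m : M) : class1 (coboundary m) = 0.
Proof. by apply/class1_eq0; exists m. Qed.

Lemma class1_shift M (c : Z1 M) m : class1 (c - coboundary m) = class1 c.
Proof.
have := class1D (c - coboundary m) (coboundary m).
by rewrite class1_coboundary addr0 subrK.
Qed.

(** Joint injectivity makes the pointwise lift unique, so the cocycle identity and continuity are
    inherited from [c] and [d]. Every later lifting of classes reduces to this. *)
Lemma cocycle_lift N A B (q : ghom N A) (r : ghom N B) (c : Z1 A) (d : Z1 B) :
  (forall x, q x = 0 -> r x = 0 -> x = 0) ->
  (forall s, exists x, q x = c s /\ r x = d s) ->
  exists e : Z1 N, forall s, q (e s) = c s /\ r (e s) = d s.
Proof.
move=> qr0 /choice[e eP].
have qr_inj x y : q x = q y -> r x = r y -> x = y.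
  move=> qE rE; apply/eqP; rewrite -subr_eq0; apply/eqP.
  by apply: qr0; rewrite ghB ?qE ?rE subrr.
suff eZ : e \in @cocycle_pred G N by exists (MkZ1 eZ).
have [cM cO] := z1_cocycle c; have [dM dO] := z1_cocycle d.
have eq s : q (e s) = c s by case: (eP s).
have er s : r (e s) = d s by case: (eP s).
apply/asboolP; split => [s t|W].
  by apply: qr_inj; rewrite ghD gh_act ?eq ?er.
rewrite (_ : e @^-1` W = \bigcup_(x in W) (c @^-1` [set q x] `&` d @^-1` [set r x])).
  by apply: bigcup_open => x _; apply: openI.
apply/seteqP; split => s /=; first by move=> Ws; exists (e s); rewrite //= eq er.
move=> [x Wx [/= cs ds]]; rewrite (_ : e s = x) //.
by apply: qr_inj; rewrite ?eq ?er.
Qed.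

Lemma H1_fibre_lift N A B C (q : ghom N A) (r : ghom N B) (p : ghom A C) (f : ghom B C) x y :
  (forall n, q n = 0 -> r n = 0 -> n = 0) ->
  (forall a b, p a = f b -> exists n, q n = a /\ r n = b) ->
  (forall z, exists a, p a = z) ->
  H1map p x = H1map f y -> exists z, H1map q z = x /\ H1map r z = y.
Proof.
move=> qr0 fib psurj; rewrite -(class1_repr x) -(class1_repr y) !H1mapE.
move: (repr x) (repr y) => c d /class1_eq[z zE]; have [a pa] := psurj z.
(* The images of [c] and [d] in [C] differ by the coboundary of [z]; subtracting from [c] the
   coboundary of a lift [a] of [z] makes them equal pointwise. *)
have [s|e eP] := @cocycle_lift N A B q r (c - coboundary a) d qr0.
  apply: fib; rewrite z1B ghB /= ghB gh_act pa -zE z1B /=.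
  by rewrite opprB addrC subrK.
exists (class1 e); rewrite !H1mapE -(class1_shift c a).
by split; congr class1; apply: val_inj; apply/funext => s; case: (eP s).
Qed.

(** Once corrected by a coboundary, the cocycle takes values in the kernel of [p], and it lifts
    through [i], which plays both roles in [cocycle_lift]. *)
Lemma H1_exact A B C (i : ghom A B) (p : ghom B C) x :
  injective i -> (forall b, p b = 0 -> exists a, i a = b) ->
  (forall z, exists b, p b = z) ->
  H1map p x = 0 -> exists y, H1map i y = x.
Proof.
move=> iI ker psurj; rewrite -(class1_repr x) H1mapE; move: (repr x) => c.
move=> /class1_eq0[z zE]; have [b pb] := psurj z.
have i0 a : i a = 0 -> i a = 0 -> a = 0 by move=> ia _; apply: iI; rewrite ia gh0.
have [s|e eP] := @cocycle_lift A B B i i (c - coboundary b) (c - coboundary b) i0.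
  have [|a ia] := ker ((c - coboundary b) s); last by exists a.
  by rewrite z1B ghB /= ghB gh_act pb -zE /= subrr.
exists (class1 e); rewrite !H1mapE -(class1_shift c b).
by congr class1; apply: val_inj; apply/funext => s; case: (eP s).
Qed.

(** The two image classes do not determine [z], but they do so together with the elements [m] whose
    coboundaries relate the images of its representative to the chosen representatives. Those
    elements range over finite modules. *)
Lemma H1_fibre_finite N A B (q : ghom N A) (r : ghom N B)
    (X : set (H1 A)) (Y : set (H1 B)) :
  (forall n, q n = 0 -> r n = 0 -> n = 0) -> finite_set X -> finite_set Y ->
  finite_set [set z | X (H1map q z) /\ Y (H1map r z)].
Proof.
move=> qr0 fX fY.
have wit M (f : ghom N M) z : exists m, forall s,
    f ((repr z : Z1 N) s) = (repr (H1map f z) : Z1 M) s + (gact s m - m).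
  have := class1_repr (H1map f z); rewrite -{2}(class1_repr z) H1mapE.
  move=> /esym/class1_eq[m mE]; exists m => s; rewrite -mE z1B /=.
  by rewrite addrC subrK.
have [a aP] := choice (wit A q); have [b bP] := choice (wit B r).
pose phi z := (H1map q z, H1map r z, (a z, b z)).
apply: sub_finite_set (_ : finite_set (phi @^-1` ((X `*` Y) `*` setT))).
  by move=> z [/= Xz Yz].
apply: finite_preimage.
  move=> z w _ _ [qE rE aE bE].
  rewrite -(class1_repr z) -(class1_repr w); congr class1.
  apply: val_inj; apply/funext => s; apply/eqP; rewrite -subr_eq0; apply/eqP.
  by apply: qr0; rewrite ghB ?aP ?bP ?qE ?rE ?aE ?bE subrr.
by apply: finite_setX; [exact: finite_setX|exact: finite_finset].
Qed.

(* If x becomes the coboundary of q b + j d, then x shifted by d and the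
   coboundary of b are the images of one and the same cocycle of A. *)
Lemma H1_pushout_kernel A B C N (i : ghom A B) (g : ghom A C)
    (q : ghom B N) (j : ghom C N) x :
  injective i -> (forall n, exists b c, n = q b + j c) ->
  (forall b c, q b = j c -> exists a, i a = b /\ g a = c) ->
  H1map j x = 0 -> exists y, H1map i y = 0 /\ H1map g y = x.
Proof.
move=> iI surj po; rewrite -(class1_repr x) H1mapE; move: (repr x) => c.
move=> /class1_eq0[n nE]; have [b [d nbd]] := surj n.
have i0 a : i a = 0 -> g a = 0 -> a = 0 by move=> ia _; apply: iI; rewrite ia gh0.
have [s|e eP] := @cocycle_lift A B C i g (coboundary b) (c - coboundary d) i0.
  apply: po; rewrite z1B /= !ghB !gh_act.
  have -> : j (c s) = gact s n - n by exact: nE.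
  by rewrite nbd gactD [- (q b + _)]opprD addrACA addrK.
exists (class1 e); rewrite !H1mapE; split.
  by apply/class1_eq0; exists b => s; case: (eP s).
rewrite -(class1_shift c d); congr class1; apply: val_inj; apply/funext => s.
by case: (eP s).
Qed.
End Cohomology.

(** * From local classes to the restricted product *)

Section RestrictedProductMaps.
Variables (R : realType) (F Fs : fieldType) (iota : {rmorphism F -> Fs}).
Hypothesis F_global : global_field F.
Variable iotaP : separable_closure iota.
Variable D : forall v : place R F, local_data iota v.
Implicit Types A B C M N : gmod (gal iota).

Local Notation rp := (rprod iotaP D).
Local Notation rmap f := (@rprod_map R F Fs iota iotaP D _ _ f).

Lemma rprod_mapD A B (f : ghom A B) (x y : rp A) : rmap f (x + y) = rmap f x + rmap f y.
Proof. by apply: rprod_ext => v; exact: H1mapD. Qed.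

Lemma rprod_mapB A B (f : ghom A B) (x y : rp A) : rmap f (x - y) = rmap f x - rmap f y.
Proof. by apply: rprod_ext => v; exact: H1mapB. Qed.

Lemma rprod_map0 A B (f : ghom A B) : rmap f 0 = 0.
Proof. by apply: rprod_ext => v; exact: H1map0. Qed.

Lemma rprod_map_comp A B C (f : ghom A B) (g : ghom B C) (h : ghom A C) (x : rp A) :
  (forall a, h a = g (f a)) -> rmap h x = rmap g (rmap f x).
Proof. by move=> hE; apply: rprod_ext => v; exact: H1map_comp. Qed.

Lemma rprod_map_eq0 A B (f : ghom A B) (x : rp A) : (forall a, f a = 0) -> rmap f x = 0.
Proof. by move=> f0; apply: rprod_ext => v; exact: H1map_eq0. Qed.

Lemma rprod_map_id A (f : ghom A A) (x : rp A) : (forall a, f a = a) -> rmap f x = x.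
Proof. by move=> f1; apply: rprod_ext => v; exact: H1map_id. Qed.

Lemma unit_box_map A B (f : ghom A B) S (x : rp A) :
  unit_box S x -> unit_box S (rmap f x).
Proof.
move=> Sx v; have [x0 xu] := Sx v; split => Sv; last exact/H1ur_map/xu.
by rewrite /= x0 //; exact: H1map0.
Qed.

Lemma rprod_almost_all_ur A (x : rp A) : almost_all [set v | H1ur (x v)].
Proof. exact: rprod_finite. Qed.

(** Where inertia acts trivially on [A] and [B], coboundaries vanish on inertia, so an unramified
    image is represented by a cocycle that is zero there. Joint injectivity then kills the cocycle
    of [x] itself. *)
Lemma H1ur_reflect v N A B (q : ghom N A) (r : ghom N B) (x : H1v iotaP (D v) N) :
  unramified_at iotaP D v A -> unramified_at iotaP D v B ->
  (forall n, q n = 0 -> r n = 0 -> n = 0) ->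
  H1ur (H1v_map q x) -> H1ur (H1v_map r x) -> H1ur x.
Proof.
move=> uA uB qr0; rewrite /H1ur /H1v_map /= -(class1_repr x) !H1mapE !H1resE.
move: (repr x) => c /class1_eq0[a aE] /class1_eq0[b bE].
apply/class1_eq0; exists 0 => s; rewrite gact0 subrr; apply: qr0.
  by apply: etrans (aE s) _; rewrite /= uA subrr.
by apply: etrans (bE s) _; rewrite /= uB subrr.
Qed.

(** Local solutions chosen independently form an element of the restricted product as soon as, at
    almost all places, every solution is unramified. *)
Lemma rprod_choice N (P : forall v, set (H1v iotaP (D v) N)) :
  (forall v, exists z, P v z) ->
  almost_all [set v | forall z, P v z -> H1ur z] ->
  exists z : rp N, forall v, P v (z v).
Proof.
move=> Pex Pur; pose z v := sval (cid (Pex v)).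
have zP v : P v (z v) := svalP (cid (Pex v)).
have zR : z \in @rprod_pred R F Fs iota iotaP D N.
  by apply/asboolP; apply: sub_finite_set Pur => v /= nz h; exact/nz/h.
by exists (MkRprod zR).
Qed.

Lemma rprod_fibre_lift N A B C (q : ghom N A) (r : ghom N B) (p : ghom A C)
    (f : ghom B C) (x : rp A) (y : rp B) :
  (forall n, q n = 0 -> r n = 0 -> n = 0) ->
  (forall a b, p a = f b -> exists n, q n = a /\ r n = b) ->
  (forall z, exists a, p a = z) ->
  rmap p x = rmap f y -> exists z, rmap q z = x /\ rmap r z = y.
Proof.
move=> qr0 fib psurj xy.
have [||z zP] := @rprod_choice N
    (fun v => [set z | H1v_map q z = x v /\ H1v_map r z = y v]).
- move=> v; apply: (H1_fibre_lift (p := ghom_res (decomp iotaP (D v)) p)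
    (f := ghom_res (decomp iotaP (D v)) f)) => //.
  exact: (congr1 (fun t : rp C => t v) xy).
- have := almost_allI (almost_allI (almost_all_unramified F_global iotaP D A)
    (almost_all_unramified F_global iotaP D B))
    (almost_allI (rprod_almost_all_ur x) (rprod_almost_all_ur y)).
  apply: almost_allW => v [[uA uB] [xu yu]] z [zx zy].
  by apply: (H1ur_reflect uA uB qr0); rewrite ?zx ?zy.
by exists z; split; apply: rprod_ext => v; have [] := zP v.
Qed.

Lemma rprod_exact A B C (i : ghom A B) (p : ghom B C) (x : rp B) :
  injective i -> (forall b, p b = 0 -> exists a, i a = b) ->
  (forall z, exists b, p b = z) ->
  rmap p x = 0 -> exists y, rmap i y = x.
Proof.
move=> iI ker psurj px.
have i0 a : i a = 0 -> i a = 0 -> a = 0 by move=> ia _; apply: iI; rewrite ia gh0.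
have [||y yP] := @rprod_choice A (fun v => [set y | H1v_map i y = x v]).
- move=> v; apply: (H1_exact (p := ghom_res (decomp iotaP (D v)) p)) => //.
  exact: (congr1 (fun t : rp C => t v) px).
- have uB := almost_all_unramified F_global iotaP D B.
  apply: almost_allW (almost_allI uB (rprod_almost_all_ur x)) => v [uBv xu] y yx.
  by apply: (H1ur_reflect uBv uBv i0); rewrite yx.
by exists y; apply: rprod_ext.
Qed.

Lemma rprod_pushout_kernel A B C N (i : ghom A B) (g : ghom A C)
    (q : ghom B N) (j : ghom C N) (x : rp C) :
  injective i -> (forall n, exists b c, n = q b + j c) ->
  (forall b c, q b = j c -> exists a, i a = b /\ g a = c) ->
  rmap j x = 0 -> exists y, rmap i y = 0 /\ rmap g y = x.
Proof.
move=> iI surj po jx.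
have i0 a : i a = 0 -> i a = 0 -> a = 0 by move=> ia _; apply: iI; rewrite ia gh0.
have [||y yP] := @rprod_choice A
  (fun v => [set y | H1v_map i y = 0 /\ H1v_map g y = x v]).
- move=> v; apply: (H1_pushout_kernel (q := ghom_res (decomp iotaP (D v)) q)
    (j := ghom_res (decomp iotaP (D v)) j)) => //.
  exact: (congr1 (fun t : rp N => t v) jx).
(* Here reflection goes through [i] alone: the image of [y] is 0, hence unramified. *)
- apply: almost_allW (almost_all_unramified F_global iotaP D B) => v uBv y [y0 _].
  by apply: (H1ur_reflect uBv uBv i0); rewrite y0; exact: H1ur0.
by exists y; split; apply: rprod_ext => v; have [] := yP v.
Qed.

(** Truncation at [S]: it commutes with induced maps and moves an element unramified off [S] into a
    unit box. *)
Definition rprod_off_fun A (S : set (place R F)) (x : rp A) v : H1v iotaP (D v) A :=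
  if `[< S v >] then 0 else x v.

Lemma rprod_off_subproof A S (x : rp A) :
  rprod_off_fun S x \in @rprod_pred R F Fs iota iotaP D A.
Proof.
apply/asboolP; apply: sub_finite_set (rprod_finite x) => v /= nx xv; apply: nx.
by rewrite /rprod_off_fun; case: asboolP => // _; exact: H1ur0.
Qed.

Definition rprod_off A S (x : rp A) : rp A := MkRprod (rprod_off_subproof S x).

Lemma rprod_off_in A S (x : rp A) v : S v -> rprod_off S x v = 0.
Proof. by rewrite /= /rprod_off_fun; case: asboolP. Qed.

Lemma rprod_off_out A S (x : rp A) v : ~ S v -> rprod_off S x v = x v.
Proof. by rewrite /= /rprod_off_fun; case: asboolP. Qed.

Lemma rprod_off_map A B (f : ghom A B) S (x : rp A) :
  rmap f (rprod_off S x) = rprod_off S (rmap f x).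
Proof.
apply: rprod_ext => v; have [Sv|Sv] := pselect (S v).
  rewrite [RHS]rprod_off_in // -[LHS]/(H1v_map f (rprod_off S x v)) rprod_off_in //.
  exact: H1map0.
by rewrite [RHS]rprod_off_out // -[LHS]/(H1v_map f (rprod_off S x v)) rprod_off_out.
Qed.

Lemma rprod_off_unit_box A S T (x : rp A) :
  T `<=` S -> (forall v, ~ S v -> H1ur (x v)) -> unit_box T (rprod_off S x).
Proof.
move=> TS xu v; split => [/TS Sv|_]; first by rewrite rprod_off_in.
have [Sv|Sv] := pselect (S v); first by rewrite rprod_off_in //; exact: H1ur0.
by rewrite rprod_off_out //; exact: xu.
Qed.

Lemma rprod_off_id A S (x : rp A) : (forall v, S v -> x v = 0) -> rprod_off S x = x.
Proof.
move=> x0; apply: rprod_ext => v; have [Sv|Sv] := pselect (S v).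
  by rewrite rprod_off_in // x0.
by rewrite rprod_off_out.
Qed.
End RestrictedProductMaps.

(** The fibres of [p] are translates of the image of [i]. This makes the order of the new middle
    module prime to the characteristic. *)
Lemma card_ghom_exact (G : topGroupType) (A B C : gmod G) (i : ghom A B) (p : ghom B C) :
  injective i -> (forall b, p b = 0 <-> exists a, i a = b) ->
  (forall c, exists b, p b = c) -> #|B| = (#|A| * #|C|)%N.
Proof.
move=> iI ker psurj.
rewrite -sum1_card (partition_big p xpredT) //= mulnC -sum_nat_const.
apply: eq_bigr => c _; have [b0 b0c] := psurj c.
rewrite sum1_card -(card_codom (f := fun a => b0 + i a)); last by move=> x y /addrI /iI.
apply: eq_card => b; apply/eqP/codomP => [bc|[a ->]].
  have [|a ab] := (ker (b - b0)).1; first by rewrite ghB bc b0c subrr.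
  by exists a; rewrite ab addrC subrK.
by rewrite ghD b0c (_ : p (i a) = 0) ?addr0 //; apply/ker; exists a.
Qed.

(** * Selmer modules *)

Section Category.
Variables (R : realType) (F Fs : fieldType) (iota : {rmorphism F -> Fs}).
Hypothesis F_global : global_field F.
Variable iotaP : separable_closure iota.
Variable D : forall v : place R F, local_data iota v.
Local Notation rp := (rprod iotaP D).
Local Notation smodule := (SMod iotaP D).
Local Notation sel A := (@selmer R F Fs iota iotaP D A).

Definition smod_of_subgroup (N : gmod (gal iota))
    (oN : forall p, p \in [pchar F] -> ~~ (p %| #|N|)%N)
    (W : set (rp N)) (W0 : W 0) (WB : forall x y, W x -> W y -> W (x - y))
    (oW : open W) (bW : box_bounded W) : smodule :=
  MkSMod oN W0 WB oW (open_subgroup_compact W0 WB oW bW).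

Lemma open_subgroup_unit_box (N : gmod (gal iota)) (W : set (rp N)) S : W 0 ->
  (forall x y, W x -> W y -> W (x - y)) -> finite_set S -> unit_box S `<=` W -> open W.
Proof.
move=> W0 WB fS SW; apply: (open_of_unit_box fS) => x y Wx Sy.
by rewrite -[y]opprK; apply: WB => //; apply: SW; exact: unit_boxN.
Qed.

Definition gzero (G : topGroupType) (A B : gmod G) : ghom A B :=
  @GHom G A B (fun _ => 0) (fun _ _ => esym (addr0 0)) (fun s _ => esym (gact0 B s)).

Definition ghom_id (G : topGroupType) (A : gmod G) : ghom A A :=
  @GHom G A A id (fun _ _ => erefl) (fun _ _ => erefl).

Lemma ghom_comp_D (G : topGroupType) (A B C : gmod G) (f : ghom A B) (g : ghom B C) x y :
  g (f (x + y)) = g (f x) + g (f y).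
Proof. by rewrite !ghD. Qed.

Lemma ghom_comp_act (G : topGroupType) (A B C : gmod G) (f : ghom A B) (g : ghom B C) s x :
  g (f (gact s x)) = gact s (g (f x)).
Proof. by rewrite !gh_act. Qed.

Definition ghom_comp (G : topGroupType) (A B C : gmod G) (f : ghom A B) (g : ghom B C) :
  ghom A C := GHom (ghom_comp_D f g) (ghom_comp_act f g).

Lemma shomP (A B : smodule) (f : shom A B) x : sel A x -> sel B (rprod_map f x).
Proof. by move=> Ax; apply: (shom_selmer (s := f)); exists x. Qed.

Lemma shom_build (A B : smodule) (f : ghom A B) :
  (forall x, sel A x -> sel B (rprod_map f x)) ->
  rprod_map f @` sel A `<=` sel B.
Proof. by move=> h _ [x Ax <-]; exact: h. Qed.

Definition mk_shom (A B : smodule) (f : ghom A B) h : shom A B :=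
  SHom (@shom_build A B f h).

Lemma shom_id_subproof (A : smodule) x :
  sel A x -> sel A (rprod_map (ghom_id A) x).
Proof. by rewrite rprod_map_id. Qed.
Definition shom_id (A : smodule) : shom A A := mk_shom (@shom_id_subproof A).

Lemma shom_comp_subproof (A B C : smodule) (f : shom A B) (g : shom B C) x :
  sel A x -> sel C (rprod_map (ghom_comp f g) x).
Proof.
rewrite (@rprod_map_comp _ _ _ _ _ _ _ _ _ f g) // => Ax; exact/shomP/shomP.
Qed.
Definition shom_comp (A B C : smodule) (f : shom A B) (g : shom B C) : shom A C :=
  mk_shom (@shom_comp_subproof A B C f g).

(** That both [h] and [k] respect Selmer groups is what transports the two conditions on them; a
    bijective morphism alone would not do. *)
Lemma short_exact_iso (A N N' B : smodule) (i : shom A N) (p : shom N B)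
    (i' : shom A N') (p' : shom N' B) (h : shom N N') (k : shom N' N) :
  cancel h k -> cancel k h ->
  (forall a, h (i a) = i' a) -> (forall n, p' (h n) = p n) ->
  short_exact i p -> short_exact i' p'.
Proof.
move=> hk kh hi ph [iI ker psurj pre im].
have ki a : k (i' a) = i a by rewrite -hi hk.
have pk n : p (k n) = p' n by rewrite -ph kh.
have kerE n : p n = 0 <-> exists a, i a = n.
  split=> [pn|[a <-]].
    have [a _ an] : range i n by rewrite ker.
    by exists a.
  by have : [set x | p x = 0] (i a) by rewrite -ker; exists a.
split.
- by move=> a b ab; apply: iI; rewrite -!ki ab.
- apply/seteqP; split => [_ [a _ <-]|n /= n0] /=.
    by rewrite -hi ph; apply/kerE; exists a.
  have /kerE[a an] : p (k n) = 0 by rewrite pk.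
  by exists a => //; rewrite -hi an kh.
- apply/seteqP; split => // b _.
  have [n _ nb] : range p b by rewrite psurj.
  by exists (h n) => //; rewrite ph.
- rewrite -pre; apply/seteqP; split => x /= xS.
    by rewrite (@rprod_map_comp _ _ _ _ _ _ _ _ _ i' k); [exact: shomP|move=> a; rewrite ki].
  by rewrite (@rprod_map_comp _ _ _ _ _ _ _ _ _ i h); [exact: shomP|move=> a; rewrite hi].
- rewrite -im; apply/seteqP; split => _ [x xS <-].
    exists (rprod_map k x); first exact: shomP.
    by apply/esym/rprod_map_comp => a; rewrite pk.
  exists (rprod_map h x); first exact: shomP.
  by apply/esym/rprod_map_comp => a; rewrite ph.
Qed.

Section Uniqueness.
Variables (M N2 M2 : smodule) (p : shom M M2) (f : shom N2 M2).
Variables (N : smodule) (q : shom N M) (r : shom N N2).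
Hypothesis univ : is_fibre_product p f q r.

Lemma fibre_product_ext (T : smodule) (g h : shom T N) :
  (forall t, q (g t) = q (h t)) -> (forall t, r (g t) = r (h t)) -> g =1 h.
Proof.
move=> qE rE t; have [comm /(_ T (shom_comp h q) (shom_comp h r))[x|u [_ _ uniq]]] := univ.
  exact: comm.
by rewrite (uniq g) // (uniq h).
Qed.
End Uniqueness.

Lemma fibre_product_iso (M N2 M2 : smodule) (p : shom M M2) (f : shom N2 M2)
    (N N' : smodule) (q : shom N M) (r : shom N N2) (q' : shom N' M) (r' : shom N' N2) :
  is_fibre_product p f q r -> is_fibre_product p f q' r' ->
  exists (h : shom N N') (k : shom N' N),
    [/\ cancel h k, cancel k h, forall t, q' (h t) = q t & forall t, r' (h t) = r t].
Proof.
move=> u u'; have [h [hq hr _]] := u'.2 N q r u.1.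
have [k [kq kr _]] := u.2 N' q' r' u'.1.
exists h, k; split => //.
  apply: (fibre_product_ext u (g := shom_comp h k) (h := shom_id N)) => t /=.
    by rewrite kq hq.
  by rewrite kr hr.
apply: (fibre_product_ext u' (g := shom_comp k h) (h := shom_id N')) => t /=.
  by rewrite hq kq.
by rewrite hr kr.
Qed.

Lemma pushout_ext (M1 M N1 : smodule) (i : shom M1 M) (g : shom M1 N1)
    (N : smodule) (q : shom M N) (r : shom N1 N) (T : smodule) (a b : shom N T) :
  is_pushout i g q r ->
  (forall x, a (q x) = b (q x)) -> (forall x, a (r x) = b (r x)) -> a =1 b.
Proof.
move=> [comm univ] qE rE y.
have [x|u [_ _ uniq]] := univ T (shom_comp q b) (shom_comp r b).
  by rewrite /= comm.
by rewrite (uniq a) // (uniq b).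
Qed.

Lemma pushout_iso (M1 M N1 : smodule) (i : shom M1 M) (g : shom M1 N1)
    (N N' : smodule) (q : shom M N) (r : shom N1 N) (q' : shom M N') (r' : shom N1 N') :
  is_pushout i g q r -> is_pushout i g q' r' ->
  exists (h : shom N N') (k : shom N' N),
    [/\ cancel h k, cancel k h, forall t, h (q t) = q' t & forall t, h (r t) = r' t].
Proof.
move=> u u'; have [h [hq hr _]] := u.2 N' q' r' u'.1.
have [k [kq kr _]] := u'.2 N q r u.1.
exists h, k; split => //.
  apply: (pushout_ext (a := shom_comp h k) (b := shom_id N) u) => t /=.
    by rewrite hq kq.
  by rewrite hr kr.
apply: (pushout_ext (a := shom_comp k h) (b := shom_id N') u') => t /=.
  by rewrite kq hq.
by rewrite kr hr.
Qed.
End Category.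

(** * Construction of one exact pullback and one exact pushout *)

Section Existence.
Variables (R : realType) (F Fs : fieldType) (iota : {rmorphism F -> Fs}).
Hypothesis F_global : global_field F.
Variable iotaP : separable_closure iota.
Variable D : forall v : place R F, local_data iota v.
Local Notation rp := (rprod iotaP D).
Local Notation smodule := (SMod iotaP D).
Local Notation sel A := (@selmer R F Fs iota iotaP D A).

Lemma selmerD (A : smodule) x y : sel A x -> sel A y -> sel A (x + y).
Proof.
move=> Ax Ay; rewrite -[y]opprK -[- y]sub0r; apply: selmerB => //.
by apply: selmerB => //; exact: selmer0.
Qed.

Lemma selmer_unit_box (A : smodule) :
  exists2 S, finite_set S & unit_box S `<=` sel A.
Proof. exact: (unit_box_of_open (@selmer_open _ _ _ _ _ _ A) (selmer0 A)). Qed.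

Lemma short_exact_ker (M1 M M2 : smodule) (i : shom M1 M) (p : shom M M2) :
  short_exact i p -> forall b, p b = 0 <-> exists a, i a = b.
Proof.
move=> [_ ker _ _ _] b; split=> [pb|[a <-]].
  have [a _ ab] : range i b by rewrite ker.
  by exists a.
by have : [set x | p x = 0] (i a) by rewrite -ker; exists a.
Qed.

Lemma short_exact_surj (M1 M M2 : smodule) (i : shom M1 M) (p : shom M M2) :
  short_exact i p -> forall c, exists b, p b = c.
Proof.
move=> [_ _ psurj _ _] c; have [b _ bc] : range p c by rewrite psurj.
by exists b.
Qed.

Lemma pchar_dvdnM (m n p : nat) : p \in [pchar F] ->
  ~~ (p %| m)%N -> ~~ (p %| n)%N -> ~~ (p %| m * n)%N.
Proof. by move=> /pcharf_prime pp; rewrite Euclid_dvdM // negb_or => -> ->. Qed.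

Lemma pullback_exists (M1 M M2 N2 : smodule) (i : shom M1 M) (p : shom M M2)
    (f : shom N2 M2) : short_exact i p ->
  exists (N : smodule) (iN : shom M1 N) (pN : shom N N2) (q : shom N M),
    [/\ is_fibre_product p f q pN, forall x, q (iN x) = i x,
        forall x, pN (iN x) = 0 & short_exact iN pN].
Proof.
move=> E; have [iI _ _ pre im] := E.
have kerE := short_exact_ker E; have psurj := short_exact_surj E.
pose N := fibre_gmod p f; pose q : ghom N M := fibre_fst p f.
pose r : ghom N N2 := fibre_snd p f.
have comm n : p (q n) = f (r n) by exact: fibre_comm.
have qr0 (n : N) : q n = 0 -> r n = 0 -> n = 0 by exact: (@fibre_ext _ _ _ _ p f n 0).
have fib a b : p a = f b -> exists n : N, q n = a /\ r n = b.
  by move=> ab; exists (MkFibre (introT eqP ab : (a, b) \in fibre_pred p f)).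
have pi0 a : p (i a) = f (gzero M1 N2 a) by rewrite [RHS]gh0; apply/kerE; exists a.
pose j : ghom M1 N := fibre_lift pi0.
have jker n : r n = 0 <-> exists a, j a = n.
  split=> [rn|[a <-] //]; have /kerE[a an] : p (q n) = 0 by rewrite comm rn gh0.
  by exists a; apply: fibre_ext.
have jI : injective j by move=> a b /(congr1 q) /iI.
have rsurj b : exists n, r n = b.
  by have [a ab] := psurj (f b); have [n [_ nb]] := fib a b ab; exists n.
pose W : set (rp N) := [set z | sel M (rprod_map q z) /\ sel N2 (rprod_map r z)].
have oN c : c \in [pchar F] -> ~~ (c %| #|N|)%N.
  move=> cF; rewrite (card_ghom_exact jI jker rsurj).
  by apply: (pchar_dvdnM cF); exact: smod_order.
have W0 : W 0 by split; rewrite rprod_map0; exact: selmer0.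
have WB x y : W x -> W y -> W (x - y).
  by move=> [x1 x2] [y1 y2]; split; rewrite rprod_mapB; exact: selmerB.
have oW : open W.
  have [S fS SM] := selmer_unit_box M; have [T fT TN] := selmer_unit_box N2.
  apply: (@open_subgroup_unit_box _ _ _ _ _ _ _ _ (S `|` T)) => //.
    by rewrite finite_setU.
  move=> x xST; split.
    by apply/SM/unit_box_map/(unit_boxS _ xST) => v; left.
  by apply/TN/unit_box_map/(unit_boxS _ xST) => v; right.
have bW : box_bounded W.
  (* The box for [W] consists of the local classes whose two images lie in the boxes of [M] and
     [N2]. Places where [M] or [N2] ramifies are added to the exceptional set so that unramified
     images can be reflected. *)
  have [S [K [fS fK SK]]] := compact_box_bounded (@selmer_compact _ _ _ _ _ _ M).
  have [T [L [fT fL TL]]] := compact_box_bounded (@selmer_compact _ _ _ _ _ _ N2).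
  pose U := ~` [set v | unramified_at iotaP D v M /\ unramified_at iotaP D v N2].
  have fU : finite_set U.
    apply: (almost_allI (almost_all_unramified F_global iotaP D M)).
    exact: almost_all_unramified.
  exists (S `|` T `|` U), (fun v => [set z | K v (H1v_map q z) /\ L v (H1v_map r z)]).
  split; first by rewrite !finite_setU.
    move=> v; exact: (H1_fibre_finite (q := ghom_res (decomp iotaP (D v)) q)
      (r := ghom_res (decomp iotaP (D v)) r) qr0 (fK v) (fL v)).
  move=> x [xM xN2] v; have [Kx Sx] := SK _ xM v; have [Lx Tx] := TL _ xN2 v.
  split => // /not_orP[/not_orP[nS nT] /contrapT[uM uN2]].
  by apply: (H1ur_reflect uM uN2 qr0); [exact: Sx|exact: Tx].
pose NS := smod_of_subgroup oN W0 WB oW bW.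
have qS x : sel NS x -> sel M (rprod_map q x) by case.
have rS x : sel NS x -> sel N2 (rprod_map r x) by case.
have jS x : sel M1 x -> sel NS (rprod_map j x).
  move=> Mx; split.
    by rewrite -(@rprod_map_comp _ _ _ _ _ _ _ _ _ j q i x) //; exact: shomP.
  rewrite -(@rprod_map_comp _ _ _ _ _ _ _ _ _ j r (gzero M1 N2) x) //.
  by rewrite rprod_map_eq0 //; exact: selmer0.
exists NS, (@mk_shom _ _ _ _ _ _ M1 NS j jS), (@mk_shom _ _ _ _ _ _ NS N2 r rS),
  (@mk_shom _ _ _ _ _ _ NS M q qS); split => //.
- split; first exact: comm.
  move=> T a b ab; have hS x : sel T x -> sel NS (rprod_map (fibre_lift ab) x).
    move=> Tx; split.
      by rewrite -(@rprod_map_comp _ _ _ _ _ _ _ _ _ (fibre_lift ab) q a x) //; exact: shomP.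
    by rewrite -(@rprod_map_comp _ _ _ _ _ _ _ _ _ (fibre_lift ab) r b x) //; exact: shomP.
  exists (@mk_shom _ _ _ _ _ _ T NS (fibre_lift ab) hS); split => // h' h1 h2 t.
  by apply: fibre_ext; [exact: h1|exact: h2].
- split.
  + exact: jI.
  + by apply/seteqP; split => [_ [a _ <-]//|n /= /jker[a an]]; exists a.
  + by apply/seteqP; split => // b _; have [n nb] := rsurj b; exists n.
  + apply/seteqP; split => x /=; last exact: jS.
    by move=> [h _]; rewrite -pre /= (@rprod_map_comp _ _ _ _ _ _ _ _ _ j q i x).
  + apply/seteqP; split => [_ [x xN <-]|y yN2]; first exact: rS.
    (* Surjectivity of the Selmer group of [M] onto that of [M2] gives a Selmer element [x] over the
       image of [y]; the pair of [x] and [y] then lifts to the fibre product. *)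
    have : sel M2 (rprod_map f y) by exact: shomP.
    rewrite -im => -[x xM xy].
    have [z [zx zy]] := rprod_fibre_lift F_global qr0 fib psurj xy.
    by exists z => //; split; rewrite ?zx ?zy.
Qed.

Lemma pushout_exists (M1 M M2 N1 : smodule) (i : shom M1 M) (p : shom M M2)
    (g : shom M1 N1) : short_exact i p ->
  exists (N : smodule) (iN : shom N1 N) (pN : shom N M2) (q : shom M N),
    [/\ is_pushout i g q iN, forall x, pN (q x) = p x,
        forall x, pN (iN x) = 0 & short_exact iN pN].
Proof.
move=> E; have [iI _ _ pre im] := E.
have kerE := short_exact_ker E; have psurj := short_exact_surj E.
pose N := pushout_gmod i g; pose q : ghom M N := pushout_inl i g.
pose j : ghom N1 N := pushout_inr i g.
have pairE b c : pushout_pair i g b c = q b + j c.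
  by rewrite -pushout_pairD addr0 add0r.
have surj (n : N) : exists b c, n = q b + j c.
  by have [b [c ->]] := pushout_pair_surj n; exists b, c.
have po b c : q b = j c -> exists a, i a = b /\ g a = c.
  by move=> /pushout_pair_eq[a []]; rewrite !subr0 => ? ?; exists a.
have comm a : q (i a) = j (g a).
  by apply/pushout_pair_eq; exists a; rewrite !subr0.
have pi0 a : p (i a) = gzero N1 M2 (g a) by apply/kerE; exists a.
pose r : ghom N M2 := pushout_desc pi0.
have rE b c : r (q b + j c) = p b.
  by rewrite -pairE; apply: etrans (pushout_descE pi0 b c) _; exact: addr0.
have rq b : r (q b) = p b by rewrite -[q b]addr0 -(gh0 j) rE.
have rj c : r (j c) = 0 by rewrite -[j c]add0r -(gh0 q) rE gh0.
have j0 c : j c = 0 -> c = 0.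
  move=> jc; have [|a [a0 <-]] := po 0 c; first by rewrite jc gh0.
  by rewrite (iI a 0) ?gh0 // a0 gh0.
have jI : injective j.
  move=> c d cd; apply/eqP; rewrite -subr_eq0; apply/eqP/j0.
  by rewrite ghB cd subrr.
have rker n : r n = 0 <-> exists c, j c = n.
  split=> [|[c <-] //]; have [b [c ->]] := surj n.
  rewrite rE => /kerE[a <-]; exists (g a + c); by rewrite comm -ghD.
have rsurj d : exists n, r n = d by have [b <-] := psurj d; exists (q b).
pose W : set (rp N) :=
  [set z | exists w w1, [/\ sel M w, sel N1 w1 & z = rprod_map q w + rprod_map j w1]].
have oN c : c \in [pchar F] -> ~~ (c %| #|N|)%N.
  move=> cF; rewrite (card_ghom_exact jI rker rsurj).
  by apply: (pchar_dvdnM cF); exact: smod_order.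
have W0 : W 0 by exists 0, 0; split; rewrite ?rprod_map0 ?addr0 //; exact: selmer0.
have WB x y : W x -> W y -> W (x - y).
  move=> [w [w1 [Mw Nw1 ->]]] [u [u1 [Mu Nu1 ->]]]; exists (w - u), (w1 - u1).
  by split; [exact: selmerB|exact: selmerB|rewrite !rprod_mapB opprD addrACA].
have [SK [K [fSK fK KP]]] := compact_box_bounded (@selmer_compact _ _ _ _ _ _ M).
have [SL [L [fSL fL LP]]] := compact_box_bounded (@selmer_compact _ _ _ _ _ _ N1).
have oW : open W.
  have [S fS SM] := selmer_unit_box M; have [T fT TN] := selmer_unit_box N1.
  have [U fU UM2] := selmer_unit_box M2.
  pose V := ~` [set v | unramified_at iotaP D v N].
  have fV : finite_set V by exact: almost_all_unramified.
  (* An element vanishing on [B] and unramified elsewhere meets three demands: [S], [T], [U] put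
     truncated elements of [M], [N1] and the image in [M2] into the Selmer groups, [V] allows
     reflection from [N], and [SK] bounds the ramification of Selmer elements of [M]. *)
  pose B := S `|` T `|` U `|` V `|` SK.
  apply: (@open_subgroup_unit_box _ _ _ _ _ _ _ _ B) => //.
    by rewrite !finite_setU.
  move=> y yB.
  have y0 v : B v -> y v = 0 by have [] := yB v.
  have yu v : ~ B v -> H1ur (y v) by have [] := yB v.
  (* Surjectivity of the Selmer group of M onto that of M2 replaces the
     vanishing of H^2 of the unramified quotient of G_v. *)
  have : sel M2 (rprod_map r y).
    by apply/UM2/unit_box_map/(unit_boxS _ yB) => v Uv; do 2![left]; right.
  (* Truncation keeps the image of [w0] in [M2] unchanged, because the image of [y] vanishes on [B],
     and puts [w] in a unit box. *)
  rewrite -im => -[w0 w0M w0y]; pose w := rprod_off B w0.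
  have wu v : ~ B v -> H1ur (w v).
    move=> nB; rewrite rprod_off_out //; have [_] := KP _ w0M v; apply.
    by move=> SKv; apply: nB; right.
  have wM : sel M w.
    apply: SM; apply: rprod_off_unit_box => v; first by move=> Sv; do 4![left].
    by move=> nB; rewrite -(rprod_off_out w0 nB); exact: wu.
  (* The difference dies in [M2], hence comes from [N1]; its preimage may be truncated too, since
     both [y] and [w] vanish on [B]. *)
  have [|z0 z0y] := rprod_exact F_global (x := y - rprod_map q w) jI (fun n => (rker n).1) rsurj.
    rewrite rprod_mapB -(@rprod_map_comp _ _ _ _ _ _ _ _ _ q r p) //.
    by rewrite rprod_off_map w0y -rprod_off_map rprod_off_id // subrr.
  pose z := rprod_off B z0.
  have zy : rprod_map j z = y - rprod_map q w.
    rewrite /z rprod_off_map z0y; apply: rprod_off_id => v Bv.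
    rewrite rprodBE y0 // -[rprod_map q w v]/(H1v_map q (w v)) rprod_off_in //.
    by rewrite [H1v_map q 0]H1map0 subrr.
  exists w, z; split => //; last by rewrite zy addrC subrK.
  apply: TN; apply: rprod_off_unit_box => v; first by move=> Tv; do 3![left]; right.
  move=> nB; have uN : unramified_at iotaP D v N.
    by apply: contrapT => nu; apply: nB; left; right.
  have : H1ur (H1v_map j (z0 v)).
    rewrite -[H1v_map j _]/(rprod_map j z0 v) z0y rprodBE.
    by apply: H1urD; [exact: yu|exact/H1urN/H1ur_map/wu].
  by move=> ju; apply: (H1ur_reflect uN uN (q := j) (r := j)) => // c /j0.
have bW : box_bounded W.
  exists (SK `|` SL),
    (fun v => [set H1v_map q a + H1v_map j b | a in K v & b in L v]).
  split; first by rewrite finite_setU.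
    by move=> v; exact: finite_image2.
  move=> _ [w [w1 [Mw Nw1 ->]]] v.
  have [Kw wu] := KP _ Mw v; have [Lw1 w1u] := LP _ Nw1 v; split.
    by exists (w v) => //; exists (w1 v).
  move=> /not_orP[nK nL]; rewrite rprodDE.
  by apply: H1urD; apply: H1ur_map; [exact: wu|exact: w1u].
pose NS := smod_of_subgroup oN W0 WB oW bW.
have qS x : sel M x -> sel NS (rprod_map q x).
  by move=> Mx; exists x, 0; split => //; [exact: selmer0|rewrite rprod_map0 addr0].
have jS x : sel N1 x -> sel NS (rprod_map j x).
  by move=> Nx; exists 0, x; split => //; [exact: selmer0|rewrite rprod_map0 add0r].
have rz (w : rp M) (w1 : rp N1) : rprod_map r (rprod_map q w + rprod_map j w1) = rprod_map p w.
  rewrite rprod_mapD -(@rprod_map_comp _ _ _ _ _ _ _ _ _ q r p) //.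
  rewrite -(@rprod_map_comp _ _ _ _ _ _ _ _ _ j r (gzero N1 M2)) //.
  by rewrite [X in _ + X]rprod_map_eq0 // addr0.
have rS x : sel NS x -> sel M2 (rprod_map r x).
  by move=> [w [w1 [Mw _ ->]]]; rewrite rz; exact: shomP.
exists NS, (@mk_shom _ _ _ _ _ _ N1 NS j jS), (@mk_shom _ _ _ _ _ _ NS M2 r rS),
  (@mk_shom _ _ _ _ _ _ M NS q qS); split => //.
- split; first exact: comm.
  move=> T a b ab; pose h := pushout_desc ab.
  have hE x y : h (q x + j y) = a x + b y by rewrite -pairE; exact: pushout_descE.
  have hq x : h (q x) = a x by rewrite -[q x]addr0 -(gh0 j) hE gh0 addr0.
  have hj x : h (j x) = b x by rewrite -[j x]add0r -(gh0 q) hE gh0 add0r.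
  have hS x : sel NS x -> sel T (rprod_map h x).
    move=> [w [w1 [Mw Nw1 ->]]]; rewrite rprod_mapD.
    apply: selmerD.
      by rewrite -(@rprod_map_comp _ _ _ _ _ _ _ _ _ q h a) //; exact: shomP.
    by rewrite -(@rprod_map_comp _ _ _ _ _ _ _ _ _ j h b) //; exact: shomP.
  exists (@mk_shom _ _ _ _ _ _ NS T h hS); split => // h' h1 h2 y.
  by have [m [c ->]] := surj y; rewrite ghD [h' (q m)]h1 [h' (j c)]h2 -hE.
- split.
  + exact: jI.
  + by apply/seteqP; split => [_ [c _ <-]|n /= /rker[c cn]]; [exact: rj|exists c].
  + by apply/seteqP; split => // d _; have [n nd] := rsurj d; exists n.
  + apply/seteqP; split => z /=; last exact: jS.
    move=> [w [w1 [Mw Nw1 zE]]].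
    (* Thus [w] comes from some [u] over [M1], a Selmer element because the Selmer group of [M1] is
       a full preimage. Since [q i = j g], subtracting [w1] and the image of [u] from [z] leaves a
       class killed by [j]. *)
    have pw : rprod_map p w = 0.
      rewrite -(rz w w1) -zE -(@rprod_map_comp _ _ _ _ _ _ _ _ _ j r (gzero N1 M2)) //.
      exact: rprod_map_eq0.
    have [u uw] := rprod_exact F_global iI (fun b => (kerE b).1) psurj pw.
    have Mu : sel M1 u by rewrite -pre /= uw.
    have : rprod_map j (z - w1 - rprod_map g u) = 0.
      rewrite !rprod_mapB zE addrK -(@rprod_map_comp _ _ _ _ _ _ _ _ _ g j (ghom_comp g j)) //.
      rewrite (@rprod_map_comp _ _ _ _ _ _ _ _ _ i q (ghom_comp g j)) ?uw ?subrr //.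
    move=> /(rprod_pushout_kernel F_global iI surj po)[y [iy gy]].
    (* A class killed by [i] maps to 0, a Selmer element of [M], so it belongs to the Selmer group
       of [M1]. *)
    have My : sel M1 y by rewrite -pre /= iy; exact: selmer0.
    have -> : z = rprod_map g y + rprod_map g u + w1 by rewrite gy !subrK.
    by apply: selmerD => //; apply: selmerD; exact: shomP.
  + apply/seteqP; split => [_ [x xN <-]|y]; first exact: rS.
    rewrite -im => -[w Mw <-]; exists (rprod_map q w); first exact: qS.
    by apply/esym/rprod_map_comp => a; rewrite rq.
Qed.
End Existence.

Theorem proposition4p2 (R : realType) (F Fs : fieldType)
  (iota : {rmorphism F -> Fs}) (F_global : global_field F)
  (iotaP : separable_closure iota)
  (D : forall v : place R F, local_data iota v)
  (M1 M M2 : SMod iotaP D) (i : shom M1 M) (p : shom M M2)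
  (E_exact : short_exact i p) :
  (forall (N2 : SMod iotaP D) (f : shom N2 M2),
     (exists (N : SMod iotaP D) (iN : shom M1 N) (pN : shom N N2),
        is_pullback_seq i p f iN pN) /\
     (forall (N : SMod iotaP D) (iN : shom M1 N) (pN : shom N N2),
        is_pullback_seq i p f iN pN -> short_exact iN pN)) /\
  (forall (N1 : SMod iotaP D) (g : shom M1 N1),
     (exists (N : SMod iotaP D) (iN : shom N1 N) (pN : shom N M2),
        is_pushout_seq i p g iN pN) /\
     (forall (N : SMod iotaP D) (iN : shom N1 N) (pN : shom N M2),
        is_pushout_seq i p g iN pN -> short_exact iN pN)).
Proof.
split => [N2 f|N1 g].
  have [N' [i' [p' [q' [u' qi' pi' E']]]]] := pullback_exists F_global f E_exact.
  split; first by exists N', i', p', q'.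
  move=> N iN pN [q [u qi pi0]].
  have [h [k [hk kh qh ph]]] := fibre_product_iso u' u.
  (* The isomorphism is only known to respect the two projections; that it carries [i'] to [iN]
     follows by comparing both sides after each projection. *)
  apply: (short_exact_iso hk kh _ ph E') => a.
  apply: (fibre_product_ext u (g := shom_comp i' h) (h := iN)) => x /=.
    by rewrite qh qi' qi.
  by rewrite ph pi' pi0.
have [N' [i' [p' [q' [u' pq' pi' E']]]]] := pushout_exists F_global g E_exact.
split; first by exists N', i', p', q'.
move=> N iN pN [q [u pq pi0]].
have [h [k [hk kh hq hi]]] := pushout_iso u' u.
apply: (short_exact_iso hk kh hi _ E').
(* Dually, the compatibility with the maps to [M2] is tested on [M] and on [N1]. *)
apply: (pushout_ext (a := shom_comp h pN) (b := p') u') => x /=.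
  by rewrite hq pq pq'.
by rewrite hi pi0 pi'.
Qed.
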